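(* Let $\varphi$ be analytic with positive real part in $\mathbb{D}$, with $\varphi(0)=1$, $\varphi'(0)>0$, $\varphi(\mathbb{D})$ symmetric with respect to the real axis, and Taylor expansion $\varphi(z)=1+B_1z+B_2z^2+B_3z^3+\cdots$ (so $B_1>0$). If $f(z)=z+\sum_{n=2}^{\infty}a_nz^n$ belongs to the class $\mathcal{H}_{\sigma}(\varphi)$, then $$|a_2|\le \frac{B_1\sqrt{B_1}}{\sqrt{|3B_1^2-4B_2+4B_1|}}\qquad\text{and}\qquad |a_3|\le\left(\frac13+\frac{B_1}{4}\right)B_1 .$$
   Context: $\mathbb{D}=\{z\in\mathbb{C}:|z|<1\}$. $\mathcal{A}$ is the class of analytic functions $f$ on $\mathbb{D}$ with $f(0)=0$ and $f'(0)=1$. A function is univalent if it is analytic and injective. A function $f\in\mathcal{A}$ is bi-univalent if both $f$ and its inverse $f^{-1}$ are univalent in $\mathbb{D}$; that is, $f$ is univalent in $\mathbb{D}$ and the inverse of $f$, defined near $0$, extends to a univalent function on $\mathbb{D}$, still denoted $g=f^{-1}$. The class of bi-univalent functions is $\sigma$. An analytic function $F$ on $\mathbb{D}$ is subordinate to an analytic function $G$ on $\mathbb{D}$, written $F\prec G$, if there is an analytic $w:\mathbb{D}\to\mathbb{D}$ with $w(0)=0$ and $F(z)=G(w(z))$ for all $z\in\mathbb{D}$. A function $f\in\sigma$ is in $\mathcal{H}_{\sigma}(\varphi)$ if $f'(z)\prec\varphi(z)$ and $g'(w)\prec\varphi(w)$, where $g=f^{-1}$. Convention: a bound whose denominator vanishes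 is regarded as $+\infty$ (no assertion). *)

(* Defs.v *)
From Stdlib Require Import Reals.
From Coquelicot Require Import Coquelicot.

Open Scope R_scope.

Definition in_disc (z : C) : Prop := Cmod z < 1.

Definition analytic_at (F : C -> C) (z0 : C) : Prop :=
  exists (c : nat -> C) (r : R), 0 < r /\
    forall z : C, Cmod (z - z0)%C < r ->
      is_pseries (K := C_AbsRing) (V := C_NormedModule) c (z - z0)%C (F z).

(* Functions on the disc are total functions [C -> C]; only their values on
   the disc matter.  In particular [C_derive] at a point of the disc, which is
   the complex derivative whenever the function is complex differentiable
   there, depends only on those values. *)
Definition analytic_on_disc (F : C -> C) : Prop :=
  forall z : C, in_disc z -> analytic_at F z.

Definition univalent (F : C -> C) : Prop :=
  analytic_on_disc F /\
  forall z1 z2 : C, in_disc z1 -> in_disc z2 -> F z1 = F z2 -> z1 = z2.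

Definition taylor_on_disc (c : nat -> C) (F : C -> C) : Prop :=
  forall z : C, in_disc z ->
    is_pseries (K := C_AbsRing) (V := C_NormedModule) c z (F z).

Definition class_A (f : C -> C) : Prop :=
  analytic_on_disc f /\ f (RtoC 0) = RtoC 0 /\ C_derive f (RtoC 0) = RtoC 1.

(* [g] is univalent on the disc and, near 0, [g w] is the preimage of [w]
   under the restriction of [f] to the disc: [g] extends the local inverse of
   [f].  By the identity theorem such a [g] is unique on the disc. *)
Definition univalent_inverse (f g : C -> C) : Prop :=
  univalent g /\
  exists r : R, 0 < r /\
    forall w : C, Cmod w < r -> in_disc (g w) /\ f (g w) = w.

Definition bi_univalent (f : C -> C) : Prop :=
  class_A f /\ univalent f /\ exists g : C -> C, univalent_inverse f g.

Definition subordinate (F G : C -> C) : Prop :=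
  exists w : C -> C,
    analytic_on_disc w /\ w (RtoC 0) = RtoC 0 /\
    forall z : C, in_disc z -> in_disc (w z) /\ F z = G (w z).

Definition H_sigma (phi f : C -> C) : Prop :=
  bi_univalent f /\
  exists g : C -> C, univalent_inverse f g /\
    subordinate (C_derive f) phi /\ subordinate (C_derive g) phi.

Definition image_disc (F : C -> C) (w : C) : Prop :=
  exists z : C, in_disc z /\ F z = w.

(* Main.v *)
Require Import Defs.
From Stdlib Require Import Reals Lra Lia Classical ClassicalEpsilon.
From Coquelicot Require Import Coquelicot.

(** Write [f'(z) = phi (u z)] and [g'(w) = phi (v w)] with Schwarz functions
    [u = u1 z + u2 z^2 + ...] and [v = v1 w + v2 w^2 + ...].  Inverting
    [f = z + a2 z^2 + a3 z^3 + ...] gives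
    [g = w - a2 w^2 + (2 a2^2 - a3) w^3 + ...]
    ([inverse_coefficients]), so comparing the coefficients of order one and two
    ([subordinate_derivative_coefficients]) yields
    - [2 a2 = B1 u1] and [- 2 a2 = B1 v1], hence [v1 = - u1];
    - [3 a3 = B1 u2 + B2 u1^2] and [6 a2^2 - 3 a3 = B1 v2 + B2 v1^2].

    The sum of the last two equations is
    [a2^2 (3 B1^2 - 4 B2) = B1^3 (u2 + v2) / 2], and their difference is
    [a3 = a2^2 + B1 (u2 - v2) / 6].  Both bounds now follow from the sharp
    inequalities [|u1| <= 1] and [|u2| <= 1 - |u1|^2], and the same for [v]
    ([coefficient_bounds]).  In the bound for [a2] the term [|u1|^2] produces
    exactly the summand [4 B1] of the denominator.

    The inequality [|u2| <= 1 - |u1|^2] is the Schwarz-Pick lemma at the origin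
    ([schwarz_coefficients]): [W = u / z] is bounded by 1, and so is
    [(W - u1) / (z (1 - conj u1 W))], whose value at 0 is [u2 / (1 - |u1|^2)].

    A function is analytic here when it has a convergent power series around
    each point, and dividing by [z] or by [1 - conj u1 W] would have to preserve
    that.  The argument therefore runs on a weaker notion, a second-order Taylor
    expansion at each point with an error of order three ([has_2jet]): it is
    plainly stable under products and reciprocals, and it suffices for the
    maximum modulus principle ([max_modulus]), because the second-order terms
    already decide the sign of the Laplacian of [|F|^2 + eps |z|^2].  The same
    calculus of functions modulo [O(z^N)] ([eqmod]) carries out all coefficient
    comparisons. *)

Open Scope R_scope.

(** * Functions modulo terms of order N at the origin *)

Definition bigO (N : nat) (E : C -> C) : Prop :=
  exists K r : R, 0 <= K /\ 0 < r /\
    forall z : C, Cmod z < r -> Cmod (E z) <= K * Cmod z ^ N.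

Definition eqmod (N : nat) (F G : C -> C) : Prop :=
  bigO N (fun z => (F z - G z)%C).

Lemma bigO_germ N E E' r :
  0 < r -> (forall z, Cmod z < r -> E z = E' z) -> bigO N E -> bigO N E'.
Proof.
  intros hr hE [K [s [hK [hs h]]]].
  exists K, (Rmin r s); split; [exact hK | split; [now apply Rmin_pos | ]].
  intros z hz.
  rewrite <- hE by (eapply Rlt_le_trans; [exact hz | apply Rmin_l]).
  apply h; eapply Rlt_le_trans; [exact hz | apply Rmin_r].
Qed.

Lemma bigO_ext N E E' : (forall z, E z = E' z) -> bigO N E -> bigO N E'.
Proof. intros hE; apply (bigO_germ N E E' 1 Rlt_0_1); intros; apply hE. Qed.

Lemma bigO_const c : bigO 0 (fun _ => c).
Proof.
  exists (Cmod c), 1; split; [apply Cmod_ge_0 | split; [lra | intros z _; simpl; lra]].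
Qed.

Lemma bigO_id : bigO 1 (fun z => z).
Proof. exists 1, 1; split; [lra | split; [lra | intros z _; simpl; lra]]. Qed.

Lemma bigO_plus N E E' : bigO N E -> bigO N E' -> bigO N (fun z => (E z + E' z)%C).
Proof.
  intros [K [r [hK [hr h]]]] [K' [r' [hK' [hr' h']]]].
  exists (K + K'), (Rmin r r'); split; [lra | split; [now apply Rmin_pos | ]].
  intros z hz.
  assert (h1 : Cmod z < r) by (eapply Rlt_le_trans; [exact hz | apply Rmin_l]).
  assert (h2 : Cmod z < r') by (eapply Rlt_le_trans; [exact hz | apply Rmin_r]).
  specialize (h z h1); specialize (h' z h2).
  eapply Rle_trans; [apply Cmod_triangle | lra].
Qed.

Lemma bigO_mult M N E E' :
  bigO M E -> bigO N E' -> bigO (M + N) (fun z => (E z * E' z)%C).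
Proof.
  intros [K [r [hK [hr h]]]] [K' [r' [hK' [hr' h']]]].
  exists (K * K'), (Rmin r r').
  split; [now apply Rmult_le_pos | split; [now apply Rmin_pos | ]].
  intros z hz.
  assert (h1 : Cmod z < r) by (eapply Rlt_le_trans; [exact hz | apply Rmin_l]).
  assert (h2 : Cmod z < r') by (eapply Rlt_le_trans; [exact hz | apply Rmin_r]).
  rewrite Cmod_mult, pow_add.
  replace (K * K' * (Cmod z ^ M * Cmod z ^ N))
    with ((K * Cmod z ^ M) * (K' * Cmod z ^ N)) by ring.
  apply Rmult_le_compat; auto using Cmod_ge_0.
Qed.

Lemma bigO_opp N E : bigO N E -> bigO N (fun z => (- E z)%C).
Proof.
  intros [K [r [hK [hr h]]]]; exists K, r; repeat split; auto.
  intros z hz; rewrite Cmod_opp; auto.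
Qed.

Lemma bigO_weaken M N E : (M <= N)%nat -> bigO N E -> bigO M E.
Proof.
  intros hMN [K [r [hK [hr h]]]].
  exists K, (Rmin r 1); split; [exact hK | split; [apply Rmin_pos; lra | ]].
  intros z hz.
  assert (h1 : Cmod z < r) by (eapply Rlt_le_trans; [exact hz | apply Rmin_l]).
  assert (h2 : Cmod z < 1) by (eapply Rlt_le_trans; [exact hz | apply Rmin_r]).
  eapply Rle_trans; [now apply h | ].
  apply Rmult_le_compat_l; [exact hK | ].
  replace N with (M + (N - M))%nat by lia; rewrite pow_add.
  rewrite <- (Rmult_1_r (Cmod z ^ M)) at 2.
  pose proof (Cmod_ge_0 z).
  apply Rmult_le_compat_l; [now apply pow_le | ].
  rewrite <- (pow1 (N - M)); apply pow_incr; lra.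
Qed.

Lemma bigO_pow N : bigO N (fun z => (z ^ N)%C).
Proof.
  exists 1, 1; split; [lra | split; [lra | intros z _]].
  rewrite Cmod_pow; lra.
Qed.

(** Composition stays inside the neighbourhood where [E] is controlled because
    [g] tends to 0 at the origin. *)
Lemma bigO_comp N E g : bigO N E -> bigO 1 g -> bigO N (fun z => E (g z)).
Proof.
  intros [K [r [hK [hr h]]]] [L [s [hL [hs hg]]]].
  exists (K * L ^ N), (Rmin s (r / (L + 1))).
  assert (hq : 0 < r / (L + 1)) by (apply Rdiv_lt_0_compat; lra).
  split; [apply Rmult_le_pos; [exact hK | now apply pow_le] | ].
  split; [now apply Rmin_pos | ].
  intros z hz.
  assert (h1 : Cmod z < s) by (eapply Rlt_le_trans; [exact hz | apply Rmin_l]).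
  assert (h2 : Cmod z < r / (L + 1))
    by (eapply Rlt_le_trans; [exact hz | apply Rmin_r]).
  specialize (hg z h1); rewrite pow_1 in hg.
  pose proof (Cmod_ge_0 z) as hz0.
  assert (hgr : Cmod (g z) < r).
  { assert (Cmod z * (L + 1) < r).
    { apply (Rmult_lt_compat_r (L + 1)) in h2; [ | lra].
      unfold Rdiv in h2; rewrite Rmult_assoc, Rinv_l, Rmult_1_r in h2; lra. }
    nra. }
  eapply Rle_trans; [now apply h | ].
  rewrite Rmult_assoc, <- Rpow_mult_distr.
  apply Rmult_le_compat_l; [exact hK | ].
  apply pow_incr; split; [apply Cmod_ge_0 | exact hg].
Qed.

(** Local boundedness of polynomial expressions in locally bounded functions.
    Powers have to be written as products. *)
Ltac bounded :=
  repeat first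
    [ assumption
    | apply bigO_const
    | apply (bigO_weaken 0 1); [lia | apply bigO_id]
    | apply (bigO_weaken 0 1); [lia | assumption]
    | apply bigO_plus | apply bigO_opp
    | apply (bigO_mult 0 0) ].

(** The way in which truncations are justified: the discarded part is exhibited
    as [z ^ N] times a locally bounded cofactor. *)
Lemma bigO_factor N E Q :
  bigO 0 Q -> (forall z, E z = (z ^ N * Q z)%C) -> bigO N E.
Proof.
  intros hQ hE.
  apply (bigO_ext _ (fun z => (z ^ N * Q z)%C)); [now intros z; rewrite hE | ].
  replace N with (N + 0)%nat by lia.
  apply bigO_mult; [replace (N + 0)%nat with N by lia; apply bigO_pow | exact hQ].
Qed.

Lemma eqmod_refl N F : eqmod N F F.
Proof.
  exists 0, 1; split; [lra | split; [lra | intros z _]].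
  replace (F z - F z)%C with (RtoC 0) by ring; rewrite Cmod_0; lra.
Qed.

Lemma eqmod_sym N F G : eqmod N F G -> eqmod N G F.
Proof.
  intros h; apply bigO_opp in h.
  eapply bigO_ext; [ | exact h]; intros z; simpl; ring.
Qed.

Lemma eqmod_trans N F G H : eqmod N F G -> eqmod N G H -> eqmod N F H.
Proof.
  intros h1 h2; pose proof (bigO_plus _ _ _ h1 h2) as h.
  eapply bigO_ext; [ | exact h]; intros z; simpl; ring.
Qed.

Lemma eqmod_germ N F G r :
  0 < r -> (forall z, Cmod z < r -> F z = G z) -> eqmod N F G.
Proof.
  intros hr h; apply (bigO_germ N (fun z => (F z - F z)%C) _ r hr).
  - intros z hz; now rewrite (h z hz).
  - apply eqmod_refl.
Qed.

Lemma eqmod_plus N F F' G G' :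
  eqmod N F F' -> eqmod N G G' ->
  eqmod N (fun z => (F z + G z)%C) (fun z => (F' z + G' z)%C).
Proof.
  intros h1 h2; pose proof (bigO_plus _ _ _ h1 h2) as h.
  eapply bigO_ext; [ | exact h]; intros z; simpl; ring.
Qed.

(** From [F G - F' G' = F' (G - G') + G (F - F')]. *)
Lemma eqmod_mult N F F' G G' :
  bigO 0 F' -> bigO 0 G -> eqmod N F F' -> eqmod N G G' ->
  eqmod N (fun z => (F z * G z)%C) (fun z => (F' z * G' z)%C).
Proof.
  intros hF hG h1 h2.
  pose proof (bigO_mult _ _ _ _ hF h2) as k1.
  pose proof (bigO_mult _ _ _ _ hG h1) as k2.
  pose proof (bigO_plus _ _ _ k1 k2) as k.
  eapply bigO_ext; [ | exact k]; intros z; simpl; ring.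
Qed.

Lemma eqmod_bounded N F G : bigO 0 G -> eqmod N F G -> bigO 0 F.
Proof.
  intros hG h; apply (bigO_weaken 0) in h; [ | lia].
  eapply bigO_ext; [ | exact (bigO_plus _ _ _ h hG)]; intros z; simpl; ring.
Qed.

Lemma eqmod_at_0 N F G : (0 < N)%nat -> eqmod N F G -> F (RtoC 0) = G (RtoC 0).
Proof.
  intros hN [K [r [hK [hr h]]]].
  specialize (h (RtoC 0)); rewrite Cmod_0, pow_i in h by exact hN.
  specialize (h hr); rewrite Rmult_0_r in h.
  apply Ceq_minus, Cmod_eq_0; apply Rle_antisym; [exact h | apply Cmod_ge_0].
Qed.

(** The form in which every limit of a small parameter is taken below. *)
Lemma le_of_le_plus_linear A D K t0 :
  0 < t0 -> (forall t, 0 < t < t0 -> A <= D + K * t) -> A <= D.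
Proof.
  intros ht h; apply le_epsilon; intros e he.
  set (t := Rmin (t0 / 2) (e / (Rabs K + 1))).
  pose proof (Rabs_pos K) as hK.
  assert (hq : 0 < e / (Rabs K + 1)) by (apply Rdiv_lt_0_compat; lra).
  assert (t1 : 0 < t) by (apply Rmin_pos; lra).
  assert (t2 : t <= t0 / 2) by apply Rmin_l.
  assert (t3 : t <= e / (Rabs K + 1)) by apply Rmin_r.
  assert (t4 : t * (Rabs K + 1) <= e).
  { apply (Rmult_le_compat_r (Rabs K + 1)) in t3; [ | lra].
    unfold Rdiv in t3; rewrite Rmult_assoc, Rinv_l, Rmult_1_r in t3; lra. }
  specialize (h t); pose proof (Rle_abs K).
  assert (A <= D + K * t) by (apply h; lra).
  nra.
Qed.

(** Dividing by [z ^ N] at a small real [z = t] leaves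
    [|p| <= (K + M) t]. *)
Lemma leading_coef_zero N p Q :
  bigO 0 Q -> bigO (S N) (fun z => (z ^ N * (p + z * Q z))%C) -> p = RtoC 0.
Proof.
  intros [M [r [hM [hr hQ]]]] [K [s [hK [hs h]]]].
  apply Cmod_eq_0, Rle_antisym; [ | apply Cmod_ge_0].
  apply (le_of_le_plus_linear _ _ (K + M) (Rmin r s)); [now apply Rmin_pos | ].
  intros t [t0 t1].
  assert (h1 : t < r) by (eapply Rlt_le_trans; [exact t1 | apply Rmin_l]).
  assert (h2 : t < s) by (eapply Rlt_le_trans; [exact t1 | apply Rmin_r]).
  assert (ht : Cmod (RtoC t) = t) by (rewrite Cmod_R, Rabs_pos_eq; lra).
  specialize (hQ t); specialize (h t); rewrite ht in hQ, h.
  specialize (hQ h1); specialize (h h2).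
  rewrite Cmod_mult, Cmod_pow, ht in h; simpl in h, hQ.
  assert (hN : 0 < t ^ N) by now apply pow_lt.
  assert (h3 : Cmod (p + t * Q t) <= K * t).
  { apply (Rmult_le_reg_l (t ^ N)); [exact hN | ].
    eapply Rle_trans; [exact h | right; ring]. }
  replace p with ((p + t * Q t) + - (t * Q t))%C by ring.
  eapply Rle_trans; [apply Cmod_triangle | ].
  rewrite Cmod_opp, Cmod_mult, ht.
  nra.
Qed.

Lemma eqmod_cubic_unique a0 a1 a2 a3 b0 b1 b2 b3 :
  eqmod 4 (fun z => a0 + a1 * z + a2 * z ^ 2 + a3 * z ^ 3)%C
          (fun z => b0 + b1 * z + b2 * z ^ 2 + b3 * z ^ 3)%C ->
  a0 = b0 /\ a1 = b1 /\ a2 = b2 /\ a3 = b3.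
Proof.
  intros h.
  assert (e0 : a0 = b0).
  { apply Ceq_minus.
    apply (leading_coef_zero 0 _ (fun z => (a1 - b1) + (a2 - b2) * z + (a3 - b3) * (z * z))%C).
    - unfold Cminus; bounded.
    - apply (bigO_weaken 1 4); [lia | ].
      eapply bigO_ext; [ | exact h]; intros z; simpl; ring. }
  subst b0.
  assert (e1 : a1 = b1).
  { apply Ceq_minus.
    apply (leading_coef_zero 1 _ (fun z => (a2 - b2) + (a3 - b3) * z)%C).
    - unfold Cminus; bounded.
    - apply (bigO_weaken 2 4); [lia | ].
      eapply bigO_ext; [ | exact h]; intros z; simpl; ring. }
  subst b1.
  assert (e2 : a2 = b2).
  { apply Ceq_minus.
    apply (leading_coef_zero 2 _ (fun z => (a3 - b3))%C).
    - unfold Cminus; bounded.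
    - apply (bigO_weaken 3 4); [lia | ].
      eapply bigO_ext; [ | exact h]; intros z; simpl; ring. }
  subst b2.
  assert (e3 : a3 = b3).
  { apply Ceq_minus.
    apply (leading_coef_zero 3 _ (fun z => RtoC 0)).
    - bounded.
    - eapply bigO_ext; [ | exact h]; intros z; simpl; ring. }
  auto.
Qed.

Lemma eqmod_quadratic_unique a0 a1 a2 b0 b1 b2 :
  eqmod 3 (fun z => a0 + a1 * z + a2 * z ^ 2)%C
          (fun z => b0 + b1 * z + b2 * z ^ 2)%C ->
  a0 = b0 /\ a1 = b1 /\ a2 = b2.
Proof.
  intros h.
  destruct (eqmod_cubic_unique (RtoC 0) a0 a1 a2 (RtoC 0) b0 b1 b2) as [_ e];
    [ | exact e].
  pose proof (bigO_mult _ _ _ _ bigO_id h) as k.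
  eapply bigO_ext; [ | exact k]; intros z; simpl; ring.
Qed.

(** * Power series and complex derivatives *)

Lemma scal_pow_n_C (c z : C) (k : nat) :
  scal (pow_n (K := C_AbsRing) z k) (c : C_NormedModule) = (c * z ^ k)%C.
Proof.
  transitivity (pow_n (K := C_AbsRing) z k * c)%C; [reflexivity | ].
  rewrite (Cmult_comm c); apply (f_equal (fun p => p * c)%C).
  induction k as [ | k IH]; [reflexivity | ].
  simpl. rewrite IH. reflexivity.
Qed.

(** The factorisation of [x^(n+1) - y^(n+1)] by [x - y] has [n + 1] terms, each
    at most [s^n]. *)
Lemma pow_diff_bound (x y : C) (s : R) (n : nat) :
  Cmod x <= s -> Cmod y <= s ->
  Cmod (x ^ S n - y ^ S n)%C <= INR (S n) * s ^ n * Cmod (x - y)%C.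
Proof.
  intros hx hy; pose proof (Cmod_ge_0 x) as hx0.
  induction n as [ | n IH].
  - simpl; right; rewrite 2 Cmult_1_r; ring.
  - replace (x ^ S (S n) - y ^ S (S n))%C
      with (x ^ S n * (x - y) + y * (x ^ S n - y ^ S n))%C by (simpl; ring).
    eapply Rle_trans; [apply Cmod_triangle | ].
    rewrite 2 Cmod_mult, Cmod_pow, (S_INR (S n)).
    pose proof (Cmod_ge_0 (x - y)%C) as hd.
    assert (h1 : Cmod x ^ S n <= s ^ S n) by (apply pow_incr; lra).
    assert (h2 : Cmod x ^ S n * Cmod (x - y)%C <= s ^ S n * Cmod (x - y)%C)
      by now apply Rmult_le_compat_r.
    assert (h3 : Cmod y * Cmod (x ^ S n - y ^ S n)%C
                 <= s * (INR (S n) * s ^ n * Cmod (x - y)%C))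
      by (apply Rmult_le_compat; auto using Cmod_ge_0).
    simpl (s ^ S n) in *.
    lra.
Qed.

Lemma INR_le_pow2 n : INR n <= 2 ^ n.
Proof.
  induction n as [ | n IH]; [simpl; lra | ].
  rewrite S_INR; simpl.
  assert (1 <= 2 ^ n) by (apply pow_R1_Rle; lra). lra.
Qed.

(** The partial sums of a convergent series are bounded, hence so are their
    successive differences, which are its terms. *)
Lemma pseries_coef_bound (c : nat -> C) (q : R) (l : C) :
  0 < q -> is_pseries (K := C_AbsRing) (V := C_NormedModule) c (RtoC q) l ->
  exists M, 0 <= M /\ forall n, Cmod (c n) * q ^ n <= M.
Proof.
  intros hq h.
  destruct (filterlim_bounded (V := C_NormedModule)
     (sum_n (fun k => scal (pow_n (K := C_AbsRing) (RtoC q) k) (c k))))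
    as [M hM].
  { exists l; exact h. }
  assert (hM' : forall n, Cmod (sum_n (fun k => scal (pow_n (K := C_AbsRing) (RtoC q) k) (c k : C_NormedModule)) n) <= M)
    by (intros n; exact (hM n)).
  assert (hM0 : 0 <= M) by (eapply Rle_trans; [apply Cmod_ge_0 | apply (hM' 0%nat)]).
  exists (2 * M); split; [lra | intros n].
  assert (e : Cmod (c n) * q ^ n = Cmod (c n * RtoC q ^ n)%C).
  { rewrite Cmod_mult, Cmod_pow, Cmod_R, Rabs_pos_eq; lra. }
  rewrite e, <- scal_pow_n_C.
  destruct n as [ | n].
  - specialize (hM' 0%nat); rewrite sum_O in hM'; lra.
  - pose proof (hM' n) as h1; pose proof (hM' (S n)) as h2.
    rewrite sum_Sn in h2.
    set (A := sum_n _ n) in *. set (T := scal _ _) in *.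
    change (plus A T) with (A + T)%C in h2.
    replace T with ((A + T) + - A)%C by ring.
    eapply Rle_trans; [apply Cmod_triangle | rewrite Cmod_opp; lra].
Qed.

Lemma norm_lim_le (u : nat -> C) (l : C) (L : R) (N : nat) :
  filterlim u eventually (locally (T := C_NormedModule) l) ->
  (forall n, (N <= n)%nat -> Cmod (u n) <= L) -> Cmod l <= L.
Proof.
  intros hu hL.
  assert (h : filterlim (fun n => norm (u n : C_NormedModule)) eventually (locally (norm (l : C_NormedModule)))).
  { eapply filterlim_comp; [exact hu | apply filterlim_norm]. }
  assert (h' : is_lim_seq (fun n => Cmod (u n)) (Cmod l)).
  { exact h. }
  apply (is_lim_seq_le_loc _ (fun _ => L) (Cmod l) L) in h'.
  - exact h'.
  - exists N; exact hL.
  - apply is_lim_seq_const.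
Qed.

Definition taylor_poly (c : nat -> C) (N : nat) (z : C) : C :=
  sum_n (G := C_AbelianMonoid) (fun k => (c k * z ^ k)%C) N.

Lemma taylor_poly_S c N z :
  taylor_poly c (S N) z = (taylor_poly c N z + c (S N) * z ^ S N)%C.
Proof. unfold taylor_poly; now rewrite sum_Sn. Qed.

Lemma taylor_poly_O c z : taylor_poly c 0 z = c 0%nat.
Proof. unfold taylor_poly; rewrite sum_O; simpl; ring. Qed.

Lemma taylor_poly_at_0 c N : taylor_poly c N (RtoC 0) = c 0%nat.
Proof.
  induction N as [ | N IH]; [apply taylor_poly_O | ].
  rewrite taylor_poly_S, IH; simpl; ring.
Qed.

Lemma is_pseries_taylor_poly (c : nat -> C) z l :
  is_pseries (K := C_AbsRing) (V := C_NormedModule) c z l ->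
  filterlim (fun n => taylor_poly c n z) eventually (locally (T := C_NormedModule) l).
Proof.
  intros h. eapply filterlim_ext; [ | exact h].
  intros n; unfold taylor_poly; apply sum_n_ext; intros k; apply scal_pow_n_C.
Qed.

(** A single estimate gives both expansions below.  With [y = 0] it bounds the
    Taylor remainder; with [x] tending to [y] it bounds the derivative of the
    remainder.  Since [|c n| <= M p^n] and [n <= 2^n], the term of index [n] is
    [M (2 p)^n s^(n-1)]-Lipschitz on the disc of radius [s], and for [4 p s <= 1]
    these constants decrease at least like a geometric series of ratio 1/2. *)
Lemma pseries_tail_lipschitz (c : nat -> C) (r : R) (F : C -> C) (N : nat) :
  0 < r ->
  (forall z, Cmod z < r -> is_pseries (K := C_AbsRing) (V := C_NormedModule) c z (F z)) ->
  exists K rho, 0 <= K /\ 0 < rho /\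
    forall (s : R) (x y : C), s < rho -> Cmod x <= s -> Cmod y <= s ->
      Cmod ((F x - taylor_poly c N x) - (F y - taylor_poly c N y))%C
      <= K * s ^ N * Cmod (x - y)%C.
Proof.
  intros hr hF.
  destruct (pseries_coef_bound c (r / 2) (F (RtoC (r / 2)))) as [M [hM hc]].
  { lra. }
  { apply hF; rewrite Cmod_R, Rabs_pos_eq; lra. }
  (* 2 / (r / 2): the factor 2 absorbs the factor n of the Lipschitz constant *)
  set (q := 2 * / (r / 2)).
  assert (hr2 : 0 < / (r / 2)) by (apply Rinv_0_lt_compat; lra).
  assert (hq : 0 < q) by (unfold q; lra).
  assert (hcn : forall n, INR n * Cmod (c n) <= M * q ^ n).
  { intros n.
    assert (h1 : Cmod (c n) <= M * (/ (r / 2)) ^ n).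
    { rewrite pow_inv.
      apply (Rmult_le_reg_r ((r / 2) ^ n)); [apply pow_lt; lra | ].
      rewrite Rmult_assoc, Rinv_l, Rmult_1_r by (apply pow_nonzero; lra).
      apply hc. }
    unfold q; rewrite Rpow_mult_distr.
    replace (M * (2 ^ n * (/ (r / 2)) ^ n)) with (2 ^ n * (M * (/ (r / 2)) ^ n)) by ring.
    apply Rmult_le_compat; [apply pos_INR | apply Cmod_ge_0 | apply INR_le_pow2 | exact h1]. }
  assert (hqi : 0 < / (2 * q)) by (apply Rinv_0_lt_compat; lra).
  exists (2 * M * q ^ S N), (Rmin r (/ (2 * q))).
  split; [apply Rmult_le_pos; [lra | apply pow_le; lra] | ].
  split; [now apply Rmin_pos | ].
  intros s x y hs hx hy.
  assert (h1 : s < r) by (eapply Rlt_le_trans; [exact hs | apply Rmin_l]).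
  assert (h2 : s < / (2 * q)) by (eapply Rlt_le_trans; [exact hs | apply Rmin_r]).
  assert (hs0 : 0 <= s) by (eapply Rle_trans; [apply Cmod_ge_0 | exact hx]).
  assert (hqs : q * s <= 1 / 2).
  { apply (Rmult_lt_compat_l (2 * q)) in h2; [ | lra].
    rewrite Rinv_r in h2; lra. }
  set (d := Cmod (x - y)%C).
  assert (hd : 0 <= d) by apply Cmod_ge_0.
  assert (bound : forall m,
    Cmod ((taylor_poly c (N + m) x - taylor_poly c N x)
          - (taylor_poly c (N + m) y - taylor_poly c N y))%C
    <= 2 * M * q ^ S N * s ^ N * d * (1 - (1 / 2) ^ m)).
  { induction m as [ | m IH].
    - replace (N + 0)%nat with N by lia.
      match goal with |- Cmod ?e <= _ => replace e with (RtoC 0) by ring end.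
      rewrite Cmod_0; simpl; lra.
    - replace (N + S m)%nat with (S (N + m)) by lia.
      rewrite 2 taylor_poly_S.
      set (n := (N + m)%nat) in *.
      match goal with |- Cmod ?e <= _ => replace e with
        (((taylor_poly c n x - taylor_poly c N x)
          - (taylor_poly c n y - taylor_poly c N y))
         + c (S n) * (x ^ S n - y ^ S n))%C by ring end.
      eapply Rle_trans; [apply Cmod_triangle | ].
      assert (ht : Cmod (c (S n) * (x ^ S n - y ^ S n))%C
                   <= M * q ^ S N * s ^ N * d * (1 / 2) ^ m).
      { rewrite Cmod_mult.
        eapply Rle_trans.
        { apply Rmult_le_compat_l; [apply Cmod_ge_0 | ].
          apply (pow_diff_bound x y s n hx hy). }
        replace (Cmod (c (S n)) * (INR (S n) * s ^ n * Cmod (x - y)%C))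
          with ((INR (S n) * Cmod (c (S n))) * (s ^ n * d)) by (unfold d; ring).
        eapply Rle_trans.
        { apply Rmult_le_compat_r; [ | apply hcn].
          apply Rmult_le_pos; [now apply pow_le | exact hd]. }
        unfold n; simpl (q ^ S _); rewrite 2 pow_add.
        replace (M * (q * (q ^ N * q ^ m)) * (s ^ N * s ^ m * d))
          with (M * (q * q ^ N) * s ^ N * d * (q * s) ^ m)
          by (rewrite Rpow_mult_distr; ring).
        apply Rmult_le_compat_l.
        - repeat apply Rmult_le_pos; try lra; apply pow_le; lra.
        - apply pow_incr; split; [apply Rmult_le_pos; lra | exact hqs]. }
      simpl ((1 / 2) ^ S m).
      lra. }
  (* the bound is uniform in m, so it survives the limit of the partial sums *)
  apply (norm_lim_le (fun n => (taylor_poly c n x - taylor_poly c N x)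
                        - (taylor_poly c n y - taylor_poly c N y))%C _ _ N).
  - assert (hx' := is_pseries_taylor_poly c x (F x) (hF x ltac:(lra))).
    assert (hy' := is_pseries_taylor_poly c y (F y) (hF y ltac:(lra))).
    assert (hxy : filterlim (fun n => plus (taylor_poly c n x : C_NormedModule)
         (opp (taylor_poly c n y))) eventually (locally (plus (F x : C_NormedModule) (opp (F y))))).
    { eapply filterlim_comp_2; [exact hx' | | apply (filterlim_plus (K := C_AbsRing) (V := C_NormedModule))].
      eapply filterlim_comp; [exact hy' | apply (filterlim_opp (K := C_AbsRing) (V := C_NormedModule))]. }
    set (D := (taylor_poly c N y - taylor_poly c N x)%C).
    assert (hD : filterlim (fun n => plus (plus (taylor_poly c n x : C_NormedModule)
         (opp (taylor_poly c n y))) (D : C_NormedModule)) eventually (locally (plus (plus (F x : C_NormedModule) (opp (F y))) (D : C_NormedModule)))).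
    { eapply filterlim_comp_2; [exact hxy | apply filterlim_const | apply (filterlim_plus (K := C_AbsRing) (V := C_NormedModule))]. }
    assert (e : (F x - taylor_poly c N x - (F y - taylor_poly c N y))%C = plus (plus (F x : C_NormedModule) (opp (F y))) (D : C_NormedModule)).
    { change (F x - taylor_poly c N x - (F y - taylor_poly c N y) = (F x + - F y) + D)%C.
      unfold D; ring. }
    rewrite e. eapply filterlim_ext; [ | exact hD].
    intros n.
    change ((taylor_poly c n x + - taylor_poly c n y) + D = taylor_poly c n x - taylor_poly c N x - (taylor_poly c n y - taylor_poly c N y))%C.
    unfold D; ring.
  - intros n hn; replace n with (N + (n - N))%nat by lia.
    eapply Rle_trans; [apply bound | ].
    rewrite <- (Rmult_1_r (2 * M * q ^ S N * s ^ N * d)) at 2.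
    apply Rmult_le_compat_l.
    + repeat apply Rmult_le_pos; try lra; apply pow_le; lra.
    + assert (0 <= (1 / 2) ^ (n - N)) by (apply pow_le; lra). lra.
Qed.

Lemma pseries_at_0 c F r :
  0 < r ->
  (forall z, Cmod z < r -> is_pseries (K := C_AbsRing) (V := C_NormedModule) c z (F z)) ->
  F (RtoC 0) = c 0%nat.
Proof.
  intros hr hF.
  assert (h0 := is_pseries_taylor_poly c (RtoC 0) (F (RtoC 0))
                  (hF (RtoC 0) ltac:(rewrite Cmod_0; lra))).
  apply Ceq_minus, Cmod_eq_0, Rle_antisym; [ | apply Cmod_ge_0].
  assert (hD : filterlim (fun n => plus (taylor_poly c n (RtoC 0) : C_NormedModule)
         (opp (c 0%nat))) eventually
         (locally (plus (F (RtoC 0) : C_NormedModule) (opp (c 0%nat : C_NormedModule))))).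
  { eapply filterlim_comp_2; [exact h0 | apply filterlim_const | apply (filterlim_plus (K := C_AbsRing) (V := C_NormedModule))]. }
  eapply (norm_lim_le _ _ 0 0 hD).
  intros n _; rewrite taylor_poly_at_0.
  change (Cmod (c 0%nat + - c 0%nat)%C <= 0).
  rewrite Cplus_opp_r, Cmod_0; lra.
Qed.

Lemma pseries_eqmod c F r N :
  0 < r ->
  (forall z, Cmod z < r -> is_pseries (K := C_AbsRing) (V := C_NormedModule) c z (F z)) ->
  eqmod (S N) F (taylor_poly c N).
Proof.
  intros hr hF.
  destruct (pseries_tail_lipschitz c r F N hr hF) as [K [rho [hK [hrho h]]]].
  exists K, rho; split; [exact hK | split; [exact hrho | ]].
  intros z hz.
  specialize (h (Cmod z) z (RtoC 0) hz (Rle_refl _)).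
  rewrite Cmod_0 in h; specialize (h (Cmod_ge_0 z)).
  rewrite (pseries_at_0 c F r hr hF), taylor_poly_at_0 in h.
  replace (F z - taylor_poly c N z - (c 0%nat - c 0%nat))%C
    with (F z - taylor_poly c N z)%C in h by ring.
  replace (z - 0)%C with z in h by ring.
  eapply Rle_trans; [exact h | simpl; right; ring].
Qed.

Lemma C_derive_eqmod F z l :
  eqmod 2 (fun h => F (z + h)%C) (fun h => F z + l * h)%C -> C_derive F z = l.
Proof.
  intros [K [r [hK [hr h]]]].
  apply is_C_derive_unique.
  split; [apply is_linear_scal_l | ].
  intros y hy e.
  assert (hyz : y = z).
  { symmetry. apply (is_filter_lim_locally_unique (K := C_AbsRing) (V := AbsRing_NormedModule C_AbsRing) z y hy). }
  subst y.
  assert (hd : 0 < Rmin r (e / (K + 1))).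
  { apply Rmin_pos; [exact hr | apply Rdiv_lt_0_compat; [apply cond_pos | lra]]. }
  exists (mkposreal _ hd); intros w hw; change C in w.
  change (Cmod (w - z)%C < Rmin r (e / (K + 1))) in hw.
  change (Cmod ((F w - F z) - (w - z) * l)%C <= e * Cmod (w - z)%C).
  assert (h1 : Cmod (w - z)%C < r) by (eapply Rlt_le_trans; [exact hw | apply Rmin_l]).
  assert (h2 : Cmod (w - z)%C < e / (K + 1)) by (eapply Rlt_le_trans; [exact hw | apply Rmin_r]).
  specialize (h (w - z)%C h1).
  replace (z + (w - z))%C with w in h by ring.
  replace (F w - F z - (w - z) * l)%C with (F w - (F z + l * (w - z)))%C by ring.
  eapply Rle_trans; [exact h | ].
  pose proof (Cmod_ge_0 (w - z)%C) as hp.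
  assert (h3 : Cmod (w - z)%C * (K + 1) < e).
  { apply (Rmult_lt_compat_r (K + 1)) in h2; [ | lra].
    unfold Rdiv in h2; rewrite Rmult_assoc, Rinv_l, Rmult_1_r in h2; lra. }
  simpl; nra.
Qed.

Lemma analytic_at_pseries F z0 :
  analytic_at F z0 -> exists c r, 0 < r /\ forall h, Cmod h < r ->
    is_pseries (K := C_AbsRing) (V := C_NormedModule) c h (F (z0 + h)%C).
Proof.
  intros [c [r [hr h]]]; exists c, r; split; [exact hr | ].
  intros k hk; specialize (h (z0 + k)%C).
  replace (z0 + k - z0)%C with k in h by ring; auto.
Qed.

Lemma analytic_at_derive F z :
  analytic_at F z -> eqmod 2 (fun h => F (z + h)%C) (fun h => F z + C_derive F z * h)%C.
Proof.
  intros hF; destruct (analytic_at_pseries F z hF) as [c [r [hr h]]].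
  pose proof (pseries_eqmod c _ r 1 hr h) as e.
  pose proof (pseries_at_0 c _ r hr h) as e0; simpl in e0.
  replace (z + 0)%C with z in e0 by ring.
  assert (k : eqmod 2 (fun h => F (z + h)%C) (fun h => F z + c 1%nat * h)%C).
  { eapply bigO_ext; [ | exact e]; intros x.
    simpl; rewrite taylor_poly_S, taylor_poly_O, e0; simpl; ring. }
  now rewrite (C_derive_eqmod F z _ k).
Qed.

(** The derivative at [z] is compared with that of the cubic Taylor polynomial
    through difference quotients along a real step [t]: the remainder is
    Lipschitz with constant [K (|z| + t)^3] near [z], so letting [t] tend to 0
    bounds the difference of the derivatives by [K |z|^3]. *)
Lemma C_derive_pseries_eqmod c F r :
  0 < r ->
  (forall z, Cmod z < r -> is_pseries (K := C_AbsRing) (V := C_NormedModule) c z (F z)) ->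
  (forall z, Cmod z < r -> analytic_at F z) ->
  eqmod 3 (C_derive F)
    (fun z => c 1%nat + 2 * c 2%nat * z + 3 * c 3%nat * z ^ 2)%C.
Proof.
  intros hr hF han.
  destruct (pseries_tail_lipschitz c r F 3 hr hF) as [K [rho [hK [hrho hL]]]].
  exists K, (Rmin (Rmin r 1) rho); split; [exact hK | ].
  split; [repeat apply Rmin_pos; lra | ].
  intros z hz.
  assert (z1 : Cmod z < r).
  { eapply Rlt_le_trans; [exact hz | ]. eapply Rle_trans; [apply Rmin_l | apply Rmin_l]. }
  assert (z2 : Cmod z < 1).
  { eapply Rlt_le_trans; [exact hz | ]. eapply Rle_trans; [apply Rmin_l | apply Rmin_r]. }
  assert (z3 : Cmod z < rho) by (eapply Rlt_le_trans; [exact hz | apply Rmin_r]).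
  set (P' := (c 1%nat + 2 * c 2%nat * z + 3 * c 3%nat * z ^ 2)%C).
  set (l := C_derive F z).
  (* Taylor expansion around z of the cubic polynomial, with its remainder *)
  assert (hP : forall h, (taylor_poly c 3 (z + h) - taylor_poly c 3 z
             = P' * h + h ^ 2 * (c 2%nat + c 3%nat * (3 * z + h)))%C).
  { intros h; unfold P'; rewrite !taylor_poly_S, !taylor_poly_O; simpl; ring. }
  destruct (analytic_at_derive F z (han z z1)) as [K1 [r1 [hK1 [hr1 h1]]]].
  fold l in h1; simpl in h1.
  set (S0 := Cmod (c 2%nat) + Cmod (c 3%nat) * 4).
  pose proof (Cmod_ge_0 z) as hz0.
  apply (le_of_le_plus_linear _ _ (7 * K + K1 + S0) (Rmin (Rmin r1 1) (rho - Cmod z))).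
  { repeat apply Rmin_pos; lra. }
  intros t [t0 ht].
  assert (t1 : t < r1).
  { eapply Rlt_le_trans; [exact ht | ]. eapply Rle_trans; [apply Rmin_l | apply Rmin_l]. }
  assert (t2 : t < 1).
  { eapply Rlt_le_trans; [exact ht | ]. eapply Rle_trans; [apply Rmin_l | apply Rmin_r]. }
  assert (t3 : t < rho - Cmod z) by (eapply Rlt_le_trans; [exact ht | apply Rmin_r]).
  assert (mt : Cmod (RtoC t) = t) by (rewrite Cmod_R, Rabs_pos_eq; lra).
  assert (mzt : Cmod (z + t)%C <= Cmod z + t)
    by (eapply Rle_trans; [apply Cmod_triangle | rewrite mt; lra]).
  specialize (h1 t); rewrite mt in h1; specialize (h1 t1).
  specialize (hL (Cmod z + t) (z + t)%C z ltac:(lra) mzt ltac:(lra)).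
  replace (z + t - z)%C with (RtoC t) in hL by ring; rewrite mt in hL.
  assert (e : ((l - P') * t = (F (z + t) - taylor_poly c 3 (z + t)
             - (F z - taylor_poly c 3 z)) - (F (z + t) - (F z + l * t))
             + t ^ 2 * (c 2%nat + c 3%nat * (3 * z + t)))%C).
  { specialize (hP t).
    replace (F (z + t) - taylor_poly c 3 (z + t) - (F z - taylor_poly c 3 z))%C
      with (F (z + t) - F z - (taylor_poly c 3 (z + t) - taylor_poly c 3 z))%C by ring.
    rewrite hP; ring. }
  assert (hS : Cmod (t ^ 2 * (c 2%nat + c 3%nat * (3 * z + t)))%C <= t ^ 2 * S0).
  { rewrite Cmod_mult, Cmod_pow, mt.
    apply Rmult_le_compat_l; [apply pow2_ge_0 | ].
    eapply Rle_trans; [apply Cmod_triangle | ].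
    unfold S0; apply Rplus_le_compat_l; rewrite Cmod_mult.
    apply Rmult_le_compat_l; [apply Cmod_ge_0 | ].
    eapply Rle_trans; [apply Cmod_triangle | ].
    rewrite Cmod_mult, Cmod_R, mt, Rabs_pos_eq; lra. }
  assert (main : Cmod (l - P')%C * t <= t * (K * Cmod z ^ 3 + (7 * K + K1 + S0) * t)).
  { rewrite <- mt at 1; rewrite <- Cmod_mult, e.
    eapply Rle_trans; [apply Cmod_triangle | ].
    unfold Cminus at 1.
    eapply Rle_trans; [apply Rplus_le_compat_r, Cmod_triangle | ].
    rewrite Cmod_opp.
    assert (hK3 : K * (Cmod z + t) ^ 3 * t <= t * (K * Cmod z ^ 3 + 7 * K * t)).
    { assert ((Cmod z + t) ^ 3 <= Cmod z ^ 3 + 7 * t).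
      { assert (3 * Cmod z ^ 2 + 3 * Cmod z * t + t ^ 2 <= 7) by nra.
        replace ((Cmod z + t) ^ 3) with
         (Cmod z ^ 3 + t * (3 * Cmod z ^ 2 + 3 * Cmod z * t + t ^ 2)) by ring.
        nra. }
      assert (K * (Cmod z + t) ^ 3 <= K * (Cmod z ^ 3 + 7 * t))
        by now apply Rmult_le_compat_l.
      nra. }
    simpl in h1.
    eapply Rle_trans; [apply Rplus_le_compat; [apply Rplus_le_compat | ] | ].
    - exact hL.
    - exact h1.
    - exact hS.
    - lra. }
  apply (Rmult_le_reg_l t); [exact t0 | ].
  lra.
Qed.

(** * Second-order expansions at a point *)

Definition has_2jet (F : C -> C) (z0 : C) : Prop :=
  exists c0 c1 c2 : C,
    eqmod 3 (fun h => F (z0 + h)%C) (fun h => c0 + c1 * h + c2 * h ^ 2)%C.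

Lemma has_2jet_germ F G z0 r :
  0 < r -> (forall z, Cmod (z - z0)%C < r -> F z = G z) ->
  has_2jet F z0 -> has_2jet G z0.
Proof.
  intros hr h [c0 [c1 [c2 hF]]]; exists c0, c1, c2.
  eapply eqmod_trans; [ | exact hF].
  apply (eqmod_germ _ _ _ r hr); intros k hk; symmetry; apply h.
  now replace (z0 + k - z0)%C with k by ring.
Qed.

Lemma has_2jet_const c z0 : has_2jet (fun _ => c) z0.
Proof.
  exists c, (RtoC 0), (RtoC 0); apply (eqmod_germ _ _ _ 1 Rlt_0_1); intros; ring.
Qed.

Lemma has_2jet_id z0 : has_2jet (fun z => z) z0.
Proof.
  exists z0, (RtoC 1), (RtoC 0); apply (eqmod_germ _ _ _ 1 Rlt_0_1); intros; ring.
Qed.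

Lemma has_2jet_plus F G z0 :
  has_2jet F z0 -> has_2jet G z0 -> has_2jet (fun z => F z + G z)%C z0.
Proof.
  intros [c0 [c1 [c2 hF]]] [d0 [d1 [d2 hG]]].
  exists (c0 + d0)%C, (c1 + d1)%C, (c2 + d2)%C.
  eapply eqmod_trans; [exact (eqmod_plus _ _ _ _ _ hF hG) | ].
  apply (eqmod_germ _ _ _ 1 Rlt_0_1); intros; ring.
Qed.

Lemma bigO_quadratic c0 c1 c2 : bigO 0 (fun h => c0 + c1 * h + c2 * h ^ 2)%C.
Proof.
  apply (bigO_ext _ (fun h => c0 + c1 * h + c2 * (h * h))%C);
    [intros z; simpl; ring | bounded].
Qed.

Lemma has_2jet_mult F G z0 :
  has_2jet F z0 -> has_2jet G z0 -> has_2jet (fun z => F z * G z)%C z0.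
Proof.
  intros [c0 [c1 [c2 hF]]] [d0 [d1 [d2 hG]]].
  exists (c0 * d0)%C, (c0 * d1 + c1 * d0)%C, (c0 * d2 + c1 * d1 + c2 * d0)%C.
  eapply eqmod_trans.
  { apply eqmod_mult; [ | | exact hF | exact hG]; [apply bigO_quadratic | ].
    eapply eqmod_bounded; [apply bigO_quadratic | exact hG]. }
  apply (bigO_factor _ _ (fun h => (c1 * d2 + c2 * d1) + c2 * d2 * h)%C).
  - bounded.
  - intros h; simpl; ring.
Qed.

(** Near the origin [|G|] is at least [|c| / 2]. *)
Lemma bigO_inv G c :
  c <> RtoC 0 -> eqmod 1 G (fun _ => c) -> bigO 0 (fun h => / G h)%C /\
  exists r, 0 < r /\ forall h, Cmod h < r -> G h <> RtoC 0.
Proof.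
  intros hc [K [r [hK [hr h]]]].
  apply Cmod_gt_0 in hc.
  set (s := Rmin r (Cmod c / (2 * (K + 1)))).
  assert (hs : 0 < s) by (apply Rmin_pos; [lra | apply Rdiv_lt_0_compat; lra]).
  assert (low : forall k, Cmod k < s -> Cmod c / 2 <= Cmod (G k)).
  { intros k hk.
    assert (k1 : Cmod k < r) by (eapply Rlt_le_trans; [exact hk | apply Rmin_l]).
    assert (k2 : Cmod k < Cmod c / (2 * (K + 1)))
      by (eapply Rlt_le_trans; [exact hk | apply Rmin_r]).
    specialize (h k k1); simpl in h.
    apply (Rmult_lt_compat_r (2 * (K + 1))) in k2; [ | lra].
    unfold Rdiv in k2; rewrite Rmult_assoc, Rinv_l, Rmult_1_r in k2 by lra.
    pose proof (Cmod_ge_0 k).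
    assert (Cmod c <= Cmod (G k) + Cmod (G k - c)%C).
    { replace c with (G k + - (G k - c))%C at 1 by ring.
      eapply Rle_trans; [apply Cmod_triangle | rewrite Cmod_opp; lra]. }
    nra. }
  assert (nz : forall k, Cmod k < s -> G k <> RtoC 0).
  { intros k hk; apply Cmod_gt_0; specialize (low k hk); lra. }
  split; [ | exists s; auto].
  exists (/ (Cmod c / 2)), s; split; [left; apply Rinv_0_lt_compat; lra | ].
  split; [exact hs | intros k hk].
  rewrite Cmod_inv by now apply nz.
  rewrite Rmult_1_r; apply Rinv_le_contravar; [lra | now apply low].
Qed.

Lemma eqmod_1_of_3 F c0 c1 c2 :
  eqmod 3 F (fun h => c0 + c1 * h + c2 * h ^ 2)%C -> eqmod 1 F (fun _ => c0).
Proof.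
  intros hF; apply (bigO_weaken 1) in hF; [ | lia].
  eapply eqmod_trans; [exact hF | ].
  apply (bigO_factor _ _ (fun h => c1 + c2 * h)%C); [bounded | intros; simpl; ring].
Qed.

(** If [T] is the truncated reciprocal of the jet of [F], then [1 - F T] is of
    order three, and [1 / F - T = (1 - F T) / F]. *)
Lemma has_2jet_inv F z0 :
  F z0 <> RtoC 0 -> has_2jet F z0 -> has_2jet (fun z => / F z)%C z0.
Proof.
  intros hnz [c0 [c1 [c2 hF]]].
  assert (e0 : c0 = F z0).
  { pose proof (eqmod_at_0 _ _ _ (Nat.lt_0_succ 2) hF) as e; simpl in e.
    replace (z0 + 0)%C with z0 in e by ring; rewrite e; ring. }
  assert (hc : c0 <> RtoC 0) by now rewrite e0.
  destruct (bigO_inv _ c0 hc (eqmod_1_of_3 _ _ _ _ hF)) as [hb [r [hr hn]]].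
  (* coefficients of the reciprocal power series *)
  set (d0 := (/ c0)%C). set (d1 := (- c1 * d0 * d0)%C).
  set (d2 := (- (c1 * d1 + c2 * d0) * d0)%C).
  exists d0, d1, d2.
  set (T := fun h : C => (d0 + d1 * h + d2 * h ^ 2)%C).
  assert (hT : eqmod 3 (fun h => F (z0 + h) * T h)%C (fun _ => RtoC 1)).
  { eapply eqmod_trans.
    { apply eqmod_mult; [ | | exact hF | apply eqmod_refl]; apply bigO_quadratic. }
    apply (bigO_factor _ _ (fun h => (c1 * d2 + c2 * d1) + c2 * d2 * h)%C);
      [bounded | ].
    intros h; unfold T, d2, d1, d0; simpl; field; exact hc. }
  apply eqmod_sym in hT.
  pose proof (bigO_mult _ _ _ _ hb hT) as k.
  apply (bigO_germ _ _ _ r hr) with (2 := k).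
  intros h hh; specialize (hn h hh); fold (T h); simpl in *; field; exact hn.
Qed.

Lemma analytic_at_has_2jet F z0 : analytic_at F z0 -> has_2jet F z0.
Proof.
  intros hF; destruct (analytic_at_pseries F z0 hF) as [c [r [hr h]]].
  exists (c 0%nat), (c 1%nat), (c 2%nat).
  eapply eqmod_trans; [exact (pseries_eqmod c _ r 2 hr h) | ].
  apply (eqmod_germ _ _ _ 1 Rlt_0_1); intros z _.
  rewrite !taylor_poly_S, taylor_poly_O; simpl; ring.
Qed.

(** * The maximum modulus principle on discs *)

(** Compactness of the closed disc, for a property that becomes weaker as its
    parameter decreases: local validity for some [d] gives global validity for
    one [d].  It is extracted from compactness of a square, where points outside
    the disc have a neighbourhood that misses it. *)
Lemma closed_disc_uniform (P : R -> C -> Prop) (r : R) :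
  (forall d d' z, d' <= d -> P d z -> P d' z) ->
  (forall z0, Cmod z0 <= r -> exists d, 0 < d /\
     forall z, Cmod z <= r -> Cmod (z - z0)%C < d -> P d z) ->
  exists d, 0 < d /\ forall z, Cmod z <= r -> P d z.
Proof.
  intros hmono hloc.
  assert (hloc' : forall z0 : C, exists d : posreal,
    forall z, Cmod z <= r -> Cmod (z - z0)%C < 2 * d -> P d z).
  (* the factor 2 dominates sqrt 2, which relates boxes to Euclidean discs *)
  { intros z0; destruct (Rle_lt_dec (Cmod z0) r) as [h | h].
    - destruct (hloc z0 h) as [d [hd hz]].
      assert (hd2 : 0 < d / 2) by lra.
      exists (mkposreal _ hd2); simpl; intros z z1 z2.
      apply (hmono d); [lra | apply hz; [exact z1 | lra]].
    - assert (hd2 : 0 < (Cmod z0 - r) / 2) by lra.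
      exists (mkposreal _ hd2); simpl; intros z z1 z2.
      exfalso.
      assert (Cmod z0 <= Cmod z + Cmod (z - z0)%C); [ | lra].
      replace z0 with (z + - (z - z0))%C at 1 by ring.
      eapply Rle_trans; [apply Cmod_triangle | rewrite Cmod_opp; lra]. }
  assert (hchoice : exists delta : C -> posreal, forall z0 z : C,
    Cmod z <= r -> Cmod (z - z0)%C < 2 * delta z0 -> P (delta z0) z).
  { exists (fun z0 => proj1_sig (constructive_indefinite_description _ (hloc' z0))).
    exact (fun z0 => proj2_sig (constructive_indefinite_description _ (hloc' z0))). }
  destruct hchoice as [delta hdelta].
  destruct (compactness_value_2d (- r) r (- r) r (fun x y => delta (x, y)))
    as [d hd].
  exists d; split; [apply cond_pos | intros z hz].
  assert (hx : - r <= fst z <= r /\ - r <= snd z <= r).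
  { pose proof (Rmax_Cmod z) as hm.
    pose proof (Rmax_l (Rabs (fst z)) (Rabs (snd z))).
    pose proof (Rmax_r (Rabs (fst z)) (Rabs (snd z))).
    split; apply Rabs_le_between; lra. }
  apply NNPP; intros hn.
  apply (hd (fst z) (snd z) (proj1 hx) (proj2 hx)).
  intros [u [v [_ [_ [h1 [h2 h3]]]]]]; apply hn.
  apply (hmono (delta (u, v))); [exact h3 | ].
  apply hdelta; [exact hz | ].
  eapply Rle_lt_trans; [apply Cmod_2Rmax | ].
  pose proof (cond_pos (delta (u, v))) as hp.
  assert (hmax : Rmax (Rabs (fst (z - (u, v))%C)) (Rabs (snd (z - (u, v))%C)) < delta (u, v)).
  { apply Rmax_lub_lt; [exact h1 | exact h2]. }
  assert (hs2 : 0 < sqrt 2 < 2).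
  { split; [apply sqrt_lt_R0; lra | ].
    rewrite <- (sqrt_square 2) at 2 by lra; apply sqrt_lt_1; lra. }
  nra.
Qed.

Definition cont_at (h : C -> R) (z0 : C) : Prop :=
  forall e, 0 < e -> exists d, 0 < d /\
    forall z, Cmod (z - z0)%C < d -> Rabs (h z - h z0) < e.

Lemma closed_disc_max (h : C -> R) (r : R) :
  0 <= r -> (forall z, Cmod z <= r -> cont_at h z) ->
  exists z0, Cmod z0 <= r /\ forall z, Cmod z <= r -> h z <= h z0.
Proof.
  intros hr hc.
  set (E := fun x => exists z, Cmod z <= r /\ h z = x).
  assert (hb : bound E).
  { destruct (closed_disc_uniform (fun d z => d <= 0 \/ h z <= / d) r)
      as [d [hd hz]].
    - intros d d' z hdd [hd | hd].
      + left; lra.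
      + destruct (Rle_lt_dec d' 0) as [h' | h']; [now left | right].
        eapply Rle_trans; [exact hd | apply Rinv_le_contravar; lra].
    - intros z0 hz0; destruct (hc z0 hz0 1 Rlt_0_1) as [d1 [hd1 h1]].
      set (b := Rabs (h z0) + 1).
      assert (hb : 0 < b) by (unfold b; pose proof (Rabs_pos (h z0)); lra).
      exists (Rmin d1 (/ b)).
      split; [apply Rmin_pos; [exact hd1 | now apply Rinv_0_lt_compat] | ].
      intros z _ hz; right.
      assert (hz1 : Cmod (z - z0)%C < d1)
        by (eapply Rlt_le_trans; [exact hz | apply Rmin_l]).
      apply Rle_trans with b.
      + specialize (h1 z hz1); apply Rabs_def2 in h1.
        unfold b; pose proof (Rle_abs (h z0)); lra.
      + rewrite <- (Rinv_inv b) at 1; apply Rinv_le_contravar; [ | apply Rmin_r].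
        apply Rmin_pos; [exact hd1 | now apply Rinv_0_lt_compat].
    - exists (/ d); intros x [z [hz1 <-]]; destruct (hz z hz1); lra. }
  destruct (completeness E hb) as [M [hM1 hM2]].
  { exists (h (RtoC 0)), (RtoC 0); rewrite Cmod_0; auto. }
  apply NNPP; intros hn.
  (* if the supremum is not attained, it can be lowered uniformly *)
  destruct (closed_disc_uniform (fun d z => h z <= M - d) r) as [d [hd hz]].
  - intros; lra.
  - intros z0 hz0.
    assert (hlt : h z0 < M).
    { destruct (Rle_lt_dec M (h z0)) as [h' | h']; [ | exact h'].
      exfalso; apply hn; exists z0; split; [exact hz0 | intros z hz].
      apply Rle_trans with M; [apply hM1; now exists z | exact h']. }
    set (e := (M - h z0) / 2).
    assert (he : 0 < e) by (unfold e; lra).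
    destruct (hc z0 hz0 e he) as [d1 [hd1 h1]].
    exists (Rmin d1 e); split; [now apply Rmin_pos | intros z _ hz].
    assert (hz1 : Cmod (z - z0)%C < d1)
      by (eapply Rlt_le_trans; [exact hz | apply Rmin_l]).
    specialize (h1 z hz1); apply Rabs_def2 in h1.
    pose proof (Rmin_r d1 e); unfold e in *; lra.
  - assert (M <= M - d); [ | lra].
    apply hM2; intros x [z [hz1 <-]]; now apply hz.
Qed.

Lemma has_2jet_lipschitz F z0 :
  has_2jet F z0 -> exists K r, 0 <= K /\ 0 < r /\
    forall z, Cmod (z - z0)%C < r -> Cmod (F z - F z0)%C <= K * Cmod (z - z0)%C.
Proof.
  intros [c0 [c1 [c2 hF]]].
  pose proof (eqmod_1_of_3 _ _ _ _ hF) as h1.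
  pose proof (eqmod_at_0 _ _ _ (Nat.lt_0_succ 0) h1) as e; simpl in e.
  replace (z0 + 0)%C with z0 in e by ring; subst c0.
  destruct h1 as [K [r [hK [hr h]]]].
  exists K, r; split; [exact hK | split; [exact hr | intros z hz]].
  specialize (h (z - z0)%C hz); simpl in h.
  replace (z0 + (z - z0))%C with z in h by ring; lra.
Qed.

Lemma cont_at_Cmod2 F z0 : has_2jet F z0 -> cont_at (fun z => Cmod (F z) ^ 2) z0.
Proof.
  intros hF; destruct (has_2jet_lipschitz F z0 hF) as [K [r [hK [hr h]]]].
  intros e he.
  set (b := K * (K + 2 * Cmod (F z0)) + 1).
  pose proof (Cmod_ge_0 (F z0)) as hF0.
  assert (hb : 1 <= b).
  { unfold b; assert (0 <= K * (K + 2 * Cmod (F z0))) by (apply Rmult_le_pos; lra).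
    lra. }
  exists (Rmin (Rmin r 1) (e / b)).
  split; [repeat apply Rmin_pos; try lra; apply Rdiv_lt_0_compat; lra | ].
  intros z hz.
  assert (z1 : Cmod (z - z0)%C < r).
  { eapply Rlt_le_trans; [exact hz | ]. eapply Rle_trans; [apply Rmin_l | apply Rmin_l]. }
  assert (z2 : Cmod (z - z0)%C < 1).
  { eapply Rlt_le_trans; [exact hz | ]. eapply Rle_trans; [apply Rmin_l | apply Rmin_r]. }
  assert (z3 : Cmod (z - z0)%C < e / b) by (eapply Rlt_le_trans; [exact hz | apply Rmin_r]).
  specialize (h z z1).
  set (t := Cmod (z - z0)%C) in *.
  assert (ht : 0 <= t) by apply Cmod_ge_0.
  assert (z4 : t * b < e).
  { apply (Rmult_lt_compat_r b) in z3; [ | lra].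
    unfold Rdiv in z3; rewrite Rmult_assoc, Rinv_l, Rmult_1_r in z3; lra. }
  assert (h1 : Cmod (F z) <= Cmod (F z0) + K * t).
  { replace (F z) with (F z0 + (F z - F z0))%C by ring.
    eapply Rle_trans; [apply Cmod_triangle | lra]. }
  assert (h2 : Cmod (F z0) <= Cmod (F z) + K * t).
  { replace (F z0) with (F z + - (F z - F z0))%C at 1 by ring.
    eapply Rle_trans; [apply Cmod_triangle | rewrite Cmod_opp; lra]. }
  assert (hKt : K * t <= K) by nra.
  pose proof (Cmod_ge_0 (F z)) as hFz.
  replace (Cmod (F z) ^ 2 - Cmod (F z0) ^ 2)
    with ((Cmod (F z) - Cmod (F z0)) * (Cmod (F z) + Cmod (F z0))) by ring.
  rewrite Rabs_mult, (Rabs_pos_eq (_ + _)) by lra.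
  assert (h3 : Rabs (Cmod (F z) - Cmod (F z0)) <= K * t)
    by (apply Rabs_le; lra).
  apply Rle_lt_trans with (K * t * (K + 2 * Cmod (F z0))).
  - apply Rmult_le_compat; [apply Rabs_pos | lra | exact h3 | lra].
  - unfold b in z4; nra.
Qed.

(** Averaging over [t, i t, - t, - i t] removes all cross terms, as the sums of
    these numbers and of their squares vanish: this is a discrete mean value
    property of order two. *)
Lemma Cmod2_sum_four (c0 c1 c2 : C) (t : R) :
  let P := fun h : C => (c0 + c1 * h + c2 * h ^ 2)%C in
  Cmod (P t) ^ 2 + Cmod (P (Ci * t)%C) ^ 2 + Cmod (P (- t)%C) ^ 2
    + Cmod (P (- Ci * t)%C) ^ 2
  = 4 * (Cmod c0 ^ 2 + Cmod c1 ^ 2 * t ^ 2 + Cmod c2 ^ 2 * t ^ 4).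
Proof.
  intros P; unfold P; rewrite !Cmod2_alt.
  destruct c0 as [x0 y0], c1 as [x1 y1], c2 as [x2 y2]; simpl; ring.
Qed.

Lemma Cmod2_perturb (F P : C) (M e : R) :
  Cmod P <= M -> Cmod (F - P)%C <= e -> Cmod P ^ 2 - 2 * M * e <= Cmod F ^ 2.
Proof.
  intros hM he.
  pose proof (Cmod_ge_0 P); pose proof (Cmod_ge_0 F);
  pose proof (Cmod_ge_0 (F - P)%C).
  assert (h : Cmod P <= Cmod F + Cmod (F - P)%C).
  { replace P with (F + - (F - P))%C at 1 by ring.
    eapply Rle_trans; [apply Cmod_triangle | rewrite Cmod_opp; lra]. }
  destruct (Rle_lt_dec (Cmod P) (Cmod F)) as [h' | h']; nra.
Qed.

(** Summing the maximality over the four points at distance [t] from [z0] and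
    using [Cmod2_sum_four] gives [eps t^2 <= 2 M K t^3], impossible for small
    [t].  Without [eps] a constant [F] would be a counterexample. *)
Lemma no_local_max (F : C -> C) (z0 : C) (eps d : R) :
  0 < eps -> 0 < d -> has_2jet F z0 ->
  (forall z, Cmod (z - z0)%C < d ->
     Cmod (F z) ^ 2 + eps * Cmod z ^ 2 <= Cmod (F z0) ^ 2 + eps * Cmod z0 ^ 2) ->
  False.
Proof.
  intros heps hd [c0 [c1 [c2 hF]]] hmax.
  pose proof (eqmod_at_0 _ _ _ (Nat.lt_0_succ 2) hF) as e0; simpl in e0.
  replace (z0 + 0)%C with z0 in e0 by ring.
  replace (c0 + c1 * 0 + c2 * (0 * (0 * 1)))%C with c0 in e0 by ring.
  destruct hF as [K [r [hK [hr h]]]].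
  destruct (bigO_quadratic c0 c1 c2) as [M [s [hM [hs hP]]]].
  set (P := fun h : C => (c0 + c1 * h + c2 * h ^ 2)%C) in *.
  assert (eps <= 0); [ | lra].
  apply (le_of_le_plus_linear _ _ (2 * M * K) (Rmin (Rmin d r) s)).
  { repeat apply Rmin_pos; lra. }
  intros t [t0 ht].
  assert (t1 : t < d).
  { eapply Rlt_le_trans; [exact ht | ]. eapply Rle_trans; [apply Rmin_l | apply Rmin_l]. }
  assert (t2 : t < r).
  { eapply Rlt_le_trans; [exact ht | ]. eapply Rle_trans; [apply Rmin_l | apply Rmin_r]. }
  assert (t3 : t < s) by (eapply Rlt_le_trans; [exact ht | apply Rmin_r]).
  assert (point : forall k, Cmod k = t ->
    Cmod (P k) ^ 2 - 2 * M * (K * t ^ 3) + eps * Cmod (z0 + k)%C ^ 2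
    <= Cmod c0 ^ 2 + eps * Cmod z0 ^ 2).
  { intros k hk.
    specialize (hmax (z0 + k)%C).
    replace (z0 + k - z0)%C with k in hmax by ring.
    rewrite hk, e0 in hmax; specialize (hmax t1).
    specialize (h k); rewrite hk in h; specialize (h t2).
    specialize (hP k); rewrite hk in hP; specialize (hP t3).
    rewrite pow_O, Rmult_1_r in hP.
    pose proof (Cmod2_perturb _ (P k) _ _ hP h) as hpt; cbv beta in hpt; lra. }
  assert (mt : Cmod t = t) by (rewrite Cmod_R, Rabs_pos_eq; lra).
  pose proof (point (RtoC t) mt) as p1.
  pose proof (point (Ci * t)%C ltac:(rewrite Cmod_mult, Cmod_Ci, mt; ring)) as p2.
  pose proof (point (- t)%C ltac:(rewrite Cmod_opp; exact mt)) as p3.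
  pose proof (point (- Ci * t)%C
    ltac:(rewrite Cmod_mult, Cmod_opp, Cmod_Ci, mt; ring)) as p4.
  pose proof (Cmod2_sum_four c0 c1 c2 t) as e1; cbv zeta in e1.
  pose proof (Cmod2_sum_four z0 (RtoC 1) (RtoC 0) t) as e2; cbv zeta in e2.
  cbv beta in e1, e2.
  replace (z0 + 1 * t + 0 * t ^ 2)%C with (z0 + t)%C in e2 by ring.
  replace (z0 + 1 * (Ci * t) + 0 * (Ci * t) ^ 2)%C with (z0 + Ci * t)%C in e2 by ring.
  replace (z0 + 1 * (- t) + 0 * (- t) ^ 2)%C with (z0 + - t)%C in e2 by ring.
  replace (z0 + 1 * (- Ci * t) + 0 * (- Ci * t) ^ 2)%C with (z0 + - Ci * t)%C in e2 by ring.
  rewrite Cmod_0, Cmod_1 in e2.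
  unfold P in p1, p2, p3, p4.
  assert (hc1 : 0 <= Cmod c1 ^ 2 * t ^ 2)
    by (apply Rmult_le_pos; apply pow2_ge_0).
  assert (hc2 : 0 <= Cmod c2 ^ 2 * t ^ 4)
    by (apply Rmult_le_pos; apply pow_le; [apply Cmod_ge_0 | lra]).
  assert (key : eps * t ^ 2 <= 2 * M * K * t ^ 3).
  { apply (f_equal (Rmult eps)) in e2. lra. }
  apply (Rmult_le_reg_l (t ^ 2)); [apply pow_lt; lra | ].
  nra.
Qed.

(** If [|F z1| > M], a small enough [eps] makes the maximum of
    [|F|^2 + eps |z|^2] over the closed disc interior. *)
Lemma max_modulus (F : C -> C) (r M : R) :
  0 <= r -> (forall z, Cmod z <= r -> has_2jet F z) ->
  (forall z, Cmod z = r -> Cmod (F z) <= M) ->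
  forall z, Cmod z <= r -> Cmod (F z) <= M.
Proof.
  intros hr hj hM z1 hz1.
  destruct (Rle_lt_dec (Cmod (F z1)) M) as [h | hlt]; [exact h | exfalso].
  assert (hM0 : 0 <= M).
  { eapply Rle_trans; [apply Cmod_ge_0 | apply (hM (RtoC r))].
    rewrite Cmod_R, Rabs_pos_eq; lra. }
  set (eps := (Cmod (F z1) ^ 2 - M ^ 2) / (2 * (r ^ 2 + 1))).
  assert (hr2 : 0 <= r ^ 2) by apply pow2_ge_0.
  assert (hgap : 0 < Cmod (F z1) ^ 2 - M ^ 2) by nra.
  assert (heps : 0 < eps) by (apply Rdiv_lt_0_compat; lra).
  assert (hepsr : eps * r ^ 2 < Cmod (F z1) ^ 2 - M ^ 2).
  { assert (eps * (2 * (r ^ 2 + 1)) = Cmod (F z1) ^ 2 - M ^ 2)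
      by (unfold eps; field; lra).
    nra. }
  destruct (closed_disc_max (fun z => Cmod (F z) ^ 2 + eps * Cmod z ^ 2) r hr)
    as [z0 [hz0 hmax]].
  { intros z hz e he.
    assert (he2 : 0 < e / 2) by lra.
    destruct (cont_at_Cmod2 F z (hj z hz) _ he2) as [d1 [hd1 h1]].
    assert (he3 : 0 < e / (2 * eps)) by (apply Rdiv_lt_0_compat; lra).
    destruct (cont_at_Cmod2 (fun z => z) z (has_2jet_id z) _ he3) as [d2 [hd2 h2]].
    exists (Rmin d1 d2); split; [now apply Rmin_pos | intros y hy].
    specialize (h1 y ltac:(eapply Rlt_le_trans; [exact hy | apply Rmin_l])).
    specialize (h2 y ltac:(eapply Rlt_le_trans; [exact hy | apply Rmin_r])).
    apply Rabs_def2 in h1; apply Rabs_def2 in h2.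
    assert (e1 : eps * (e / (2 * eps)) = e / 2) by (field; lra).
    apply Rabs_def1; nra. }
  destruct (Rle_lt_or_eq_dec _ _ hz0) as [hin | hbd].
  - apply (no_local_max F z0 eps (r - Cmod z0) heps ltac:(lra) (hj z0 hz0)).
    intros z hz; apply hmax.
    replace z with (z0 + (z - z0))%C by ring.
    eapply Rle_trans; [apply Cmod_triangle | lra].
  - specialize (hmax z1 hz1); simpl in hmax; specialize (hM z0 hbd).
    rewrite hbd in hmax.
    pose proof (Cmod_ge_0 (F z0)); pose proof (Cmod_ge_0 z1).
    assert (Cmod (F z0) ^ 2 <= M ^ 2) by (apply pow_incr; lra).
    assert (0 <= eps * Cmod z1 ^ 2) by (apply Rmult_le_pos; [lra | apply pow2_ge_0]).
    simpl in *; lra.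
Qed.

(** * Coefficients of Schwarz functions *)

(** Schwarz lemma: on the circle of radius [1 - t] the hypothesis gives
    [|V| <= 1 / (1 - t)], which the maximum principle carries to the inside. *)
Lemma schwarz_quotient (V : C -> C) :
  (forall z, in_disc z -> has_2jet V z) ->
  (forall z, in_disc z -> Cmod (z * V z)%C <= 1) ->
  forall z, in_disc z -> Cmod (V z) <= 1.
Proof.
  intros hj hV z hz; unfold in_disc in *.
  pose proof (Cmod_ge_0 z) as hz0.
  pose proof (Cmod_ge_0 (V z)) as hv0.
  set (t0 := 1 - Cmod z).
  apply (le_of_le_plus_linear _ _ (Cmod (V z)) t0); [unfold t0; lra | ].
  intros t [ht ht0]; unfold t0 in ht0.
  assert (h : Cmod (V z) <= / (1 - t)).
  { apply (max_modulus V (1 - t)); [lra | | | lra].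
    - intros y hy; apply hj; lra.
    - intros y hy; specialize (hV y ltac:(lra)).
      rewrite Cmod_mult, hy in hV.
      apply (Rmult_le_reg_l (1 - t)); [lra | rewrite Rinv_r; lra]. }
  apply (Rmult_le_compat_r (1 - t)) in h; [ | lra].
  rewrite Rinv_l in h; lra.
Qed.

(** From [|1 - conj a w|^2 - |w - a|^2 = (1 - |a|^2) (1 - |w|^2)]. *)
Lemma mobius_bound (a w : C) :
  Cmod a < 1 -> Cmod w <= 1 ->
  (1 - Cconj a * w)%C <> RtoC 0 /\ Cmod ((w - a) * / (1 - Cconj a * w))%C <= 1.
Proof.
  intros ha hw.
  assert (nz : (1 - Cconj a * w)%C <> RtoC 0).
  { intros e; apply (f_equal Cmod) in e; rewrite Cmod_0 in e.
    assert (1 <= Cmod (1 - Cconj a * w)%C + Cmod (Cconj a * w)%C).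
    { rewrite <- Cmod_1 at 1.
      replace (RtoC 1) with ((1 - Cconj a * w) + Cconj a * w)%C at 1 by ring.
      apply Cmod_triangle. }
    rewrite Cmod_mult, Cmod_conj in H.
    pose proof (Cmod_ge_0 w); pose proof (Cmod_ge_0 a); nra. }
  split; [exact nz | ].
  rewrite Cmod_mult, Cmod_inv by exact nz.
  apply Cmod_gt_0 in nz.
  apply (Rmult_le_reg_r (Cmod (1 - Cconj a * w)%C)); [exact nz | ].
  rewrite Rmult_assoc, Rinv_l, Rmult_1_r, Rmult_1_l by lra.
  assert (e : Cmod (1 - Cconj a * w)%C ^ 2 - Cmod (w - a)%C ^ 2
              = (1 - Cmod a ^ 2) * (1 - Cmod w ^ 2)).
  { rewrite !Cmod2_alt; destruct a as [a1 a2], w as [w1 w2]; simpl; ring. }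
  pose proof (Cmod_ge_0 w); pose proof (Cmod_ge_0 a).
  assert (0 <= (1 - Cmod a ^ 2) * (1 - Cmod w ^ 2))
    by (apply Rmult_le_pos; nra).
  destruct (Rle_lt_dec (Cmod (w - a)%C) (Cmod (1 - Cconj a * w)%C)); [assumption | nra].
Qed.

(** [F z / z], with [c] as its value at the removable singularity. *)
Definition quot (F : C -> C) (c z : C) : C :=
  if Ceq_dec z (RtoC 0) then c else (F z * / z)%C.

Lemma quot_nonzero F c z : z <> RtoC 0 -> quot F c z = (F z * / z)%C.
Proof. unfold quot; destruct (Ceq_dec z (RtoC 0)); tauto. Qed.

Lemma quot_zero F c : quot F c (RtoC 0) = c.
Proof. unfold quot; destruct (Ceq_dec (RtoC 0) (RtoC 0)); tauto. Qed.

Lemma mult_quot F c z : F (RtoC 0) = RtoC 0 -> (z * quot F c z)%C = F z.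
Proof.
  intros h; destruct (Ceq_dec z (RtoC 0)) as [-> | hz].
  - rewrite h; ring.
  - rewrite quot_nonzero by exact hz; field; exact hz.
Qed.

Lemma quot_has_2jet F c z0 :
  z0 <> RtoC 0 -> has_2jet F z0 -> has_2jet (quot F c) z0.
Proof.
  intros hz h.
  apply (has_2jet_germ (fun z => F z * / z)%C _ _ (Cmod z0)).
  - now apply Cmod_gt_0.
  - intros z hlt; symmetry; apply quot_nonzero; intros ->.
    replace (0 - z0)%C with (- z0)%C in hlt by ring; rewrite Cmod_opp in hlt; lra.
  - apply has_2jet_mult; [exact h | ].
    apply has_2jet_inv; [exact hz | apply has_2jet_id].
Qed.

Lemma quot_eqmod N F c P :
  eqmod (S N) F (fun z => z * P z)%C -> P (RtoC 0) = c -> eqmod N (quot F c) P.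
Proof.
  intros [K [r [hK [hr h]]]] hP; exists K, r; split; [exact hK | split; [exact hr | ]].
  intros z hz; destruct (Ceq_dec z (RtoC 0)) as [-> | hn].
  - rewrite quot_zero, hP.
    replace (c - c)%C with (RtoC 0) by ring; rewrite Cmod_0.
    apply Rmult_le_pos; [exact hK | apply pow_le; lra].
  - rewrite quot_nonzero by exact hn; specialize (h z hz).
    pose proof (proj1 (Cmod_gt_0 z) hn) as hz0.
    replace (F z - z * P z)%C with (z * (F z * / z - P z))%C in h by (field; exact hn).
    rewrite Cmod_mult in h; simpl in h.
    apply (Rmult_le_reg_l (Cmod z)); [exact hz0 | ].
    eapply Rle_trans; [exact h | right; ring].
Qed.

Lemma has_2jet_at_0 F c0 c1 c2 :
  eqmod 3 F (fun z => c0 + c1 * z + c2 * z ^ 2)%C -> has_2jet F (RtoC 0).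
Proof.
  intros h; exists c0, c1, c2; eapply bigO_ext; [ | exact h].
  intros z; simpl; now rewrite Cplus_0_l.
Qed.

(** Two applications of [schwarz_quotient]: to [W = w / z], giving [|W| <= 1],
    then to [V / (1 - conj c1 W)] with [V = (W - c1) / z].  The denominator may
    vanish when [|c1| = 1], so the second step is done for [(1 - t) W] in place
    of [W], and [t] tends to 0.  The expansion is required up to order five
    because each of the two divisions by [z] costs one order. *)
Lemma schwarz_coefficients (w : C -> C) (c1 c2 c3 c4 : C) :
  analytic_on_disc w ->
  (forall z, in_disc z -> in_disc (w z)) ->
  eqmod 5 w (fun z => z * (c1 + c2 * z + c3 * z ^ 2 + c4 * z ^ 3))%C ->
  Cmod c1 <= 1 /\ Cmod c2 <= 1 - Cmod c1 ^ 2.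
Proof.
  intros han hmap hw.
  assert (d0 : in_disc (RtoC 0)) by (unfold in_disc; rewrite Cmod_0; lra).
  assert (w0 : w (RtoC 0) = RtoC 0).
  { rewrite (eqmod_at_0 _ _ _ (Nat.lt_0_succ 4) hw); ring. }
  set (W := quot w c1).
  assert (eW : eqmod 4 W (fun z => c1 + c2 * z + c3 * z ^ 2 + c4 * z ^ 3)%C)
    by (apply quot_eqmod; [exact hw | ring]).
  set (V := quot (fun z => W z - c1)%C c2).
  assert (eV : eqmod 3 V (fun z => c2 + c3 * z + c4 * z ^ 2)%C).
  { apply quot_eqmod; [ | ring].
    eapply bigO_ext; [ | exact eW]; intros z; simpl; ring. }
  assert (W0 : W (RtoC 0) = c1) by apply quot_zero.
  assert (V0 : V (RtoC 0) = c2) by apply quot_zero.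
  assert (hzV : forall z, (z * V z)%C = (W z - c1)%C).
  { intros z; apply (mult_quot (fun z => W z - c1)%C); rewrite W0; ring. }
  assert (jW : forall z, in_disc z -> has_2jet W z).
  { intros z hz; destruct (Ceq_dec z (RtoC 0)) as [-> | hn].
    - apply (has_2jet_at_0 _ c1 c2 c3); eapply eqmod_trans.
      + apply (bigO_weaken 3 4); [lia | exact eW].
      + apply (bigO_factor _ _ (fun _ => c4)); [bounded | intros; simpl; ring].
    - apply quot_has_2jet; [exact hn | now apply analytic_at_has_2jet, han]. }
  assert (jV : forall z, in_disc z -> has_2jet V z).
  { intros z hz; destruct (Ceq_dec z (RtoC 0)) as [-> | hn].
    - exact (has_2jet_at_0 _ _ _ _ eV).
    - apply quot_has_2jet; [exact hn | ].
      unfold Cminus; apply has_2jet_plus; [now apply jW | apply has_2jet_const]. }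
  assert (bW : forall z, in_disc z -> Cmod (W z) <= 1).
  { apply schwarz_quotient; [exact jW | intros z hz].
    unfold W; rewrite mult_quot by exact w0; left; now apply hmap. }
  assert (hc1 : Cmod c1 <= 1) by (rewrite <- W0; now apply bW).
  split; [exact hc1 | ].
  pose proof (Cmod_ge_0 c1) as hc0; pose proof (Cmod_ge_0 c2) as hc2.
  apply (le_of_le_plus_linear _ _ (Cmod c2 + 2 * Cmod c1 ^ 2) 1); [lra | ].
  intros t ht.
  set (rho := 1 - t).
  assert (hrho : Cmod (RtoC rho) = rho)
    by (rewrite Cmod_R, Rabs_pos_eq; unfold rho; lra).
  set (a := (rho * c1)%C).
  assert (ha : Cmod a < 1) by (unfold a; rewrite Cmod_mult, hrho; unfold rho; nra).
  assert (mob : forall z, in_disc z ->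
     (1 - Cconj a * (rho * W z))%C <> RtoC 0 /\
     Cmod ((rho * W z - a) * / (1 - Cconj a * (rho * W z)))%C <= 1).
  { intros z hz; apply mobius_bound; [exact ha | ].
    rewrite Cmod_mult, hrho; specialize (bW z hz).
    pose proof (Cmod_ge_0 (W z)); unfold rho; nra. }
  set (Phi := fun z => (rho * V z * / (1 - Cconj a * (rho * W z)))%C).
  assert (bPhi : Cmod (Phi (RtoC 0)) <= 1).
  { apply schwarz_quotient; [ | | exact d0].
    - intros z hz; unfold Phi; apply has_2jet_mult.
      + apply has_2jet_mult; [apply has_2jet_const | now apply jV].
      + apply has_2jet_inv; [now apply mob | ].
        unfold Cminus; apply has_2jet_plus; [apply has_2jet_const | ].
        apply (has_2jet_germ (fun z => (- (Cconj a * rho)) * W z)%C _ _ 1 Rlt_0_1);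
          [intros; ring | ].
        apply has_2jet_mult; [apply has_2jet_const | now apply jW].
    - intros z hz; unfold Phi.
      replace (z * (rho * V z * / (1 - Cconj a * (rho * W z))))%C
        with ((rho * (z * V z)) * / (1 - Cconj a * (rho * W z)))%C by ring.
      rewrite hzV.
      replace (rho * (W z - c1))%C with (rho * W z - a)%C by (unfold a; ring).
      now apply mob. }
  assert (eden : (1 - Cconj a * (rho * c1))%C = RtoC (1 - Cmod a ^ 2)).
  { fold a; rewrite RtoC_minus, Cmod2_conj; ring. }
  unfold Phi in bPhi; rewrite V0, W0, eden in bPhi.
  assert (hden : 0 < 1 - Cmod a ^ 2) by (pose proof (Cmod_ge_0 a); nra).
  assert (mden : Cmod (RtoC (1 - Cmod a ^ 2)) = 1 - Cmod a ^ 2)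
    by (rewrite Cmod_R, Rabs_pos_eq; lra).
  rewrite !Cmod_mult, hrho, Cmod_inv, mden in bPhi.
  2: { apply Cmod_gt_0; rewrite mden; exact hden. }
  apply (Rmult_le_compat_r (1 - Cmod a ^ 2)) in bPhi; [ | lra].
  rewrite Rmult_assoc, Rinv_l, Rmult_1_r in bPhi by lra.
  unfold a in bPhi; rewrite Cmod_mult, hrho in bPhi; unfold rho in bPhi.
  assert (0 <= (Cmod c1 * t) ^ 2) by apply pow2_ge_0.
  nra.
Qed.

(** * Coefficient comparison *)

Lemma disc_0 : in_disc (RtoC 0).
Proof. unfold in_disc; rewrite Cmod_0; lra. Qed.

Lemma analytic_at_0_pseries F :
  analytic_at F (RtoC 0) -> exists c r, 0 < r /\ forall z, Cmod z < r ->
    is_pseries (K := C_AbsRing) (V := C_NormedModule) c z (F z).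
Proof.
  intros hF; destruct (analytic_at_pseries F _ hF) as [c [r [hr h]]].
  exists c, r; split; [exact hr | intros z hz].
  specialize (h z hz); now rewrite Cplus_0_l in h.
Qed.

Lemma C_derive_taylor_on_disc_0 c F :
  taylor_on_disc c F -> analytic_on_disc F -> C_derive F (RtoC 0) = c 1%nat.
Proof.
  intros hc han.
  rewrite (eqmod_at_0 _ _ _ (Nat.lt_0_succ 2)
             (C_derive_pseries_eqmod c F 1 Rlt_0_1 hc han)); ring.
Qed.

Lemma taylor_poly_3 c z :
  taylor_poly c 3 z
  = (c 0%nat + c 1%nat * z + c 2%nat * z ^ 2 + c 3%nat * z ^ 3)%C.
Proof. rewrite !taylor_poly_S, taylor_poly_O; simpl; ring. Qed.

(** Substitute the expansion of [g] into that of [f] modulo [w^4] and compare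
    with the identity: order one forces
    [b 1 = 1], and then orders two and three are linear in [b 2] and [b 3]. *)
Lemma inverse_coefficients (f g : C -> C) (a b : nat -> C) (r : R) :
  0 < r -> (forall w, Cmod w < r -> f (g w) = w) ->
  eqmod 4 f (taylor_poly a 3) -> eqmod 4 g (taylor_poly b 3) ->
  a 0%nat = RtoC 0 -> a 1%nat = RtoC 1 -> b 0%nat = RtoC 0 ->
  b 2%nat = (- a 2%nat)%C /\ b 3%nat = (2 * a 2%nat ^ 2 - a 3%nat)%C.
Proof.
  intros hr hfg hf hg a0 a1 b0.
  set (P := fun z : C => (z + a 2%nat * z ^ 2 + a 3%nat * z ^ 3)%C).
  set (Q := fun z : C => (b 1%nat + b 2%nat * z + b 3%nat * (z * z))%C).
  assert (bQ : bigO 0 Q) by (unfold Q; bounded).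
  assert (hf' : eqmod 4 f P).
  { eapply bigO_ext; [ | exact hf]; intros z; simpl.
    rewrite taylor_poly_3, a0, a1; unfold P; simpl; ring. }
  assert (hg' : eqmod 4 g (fun z => z * Q z)%C).
  { eapply bigO_ext; [ | exact hg]; intros z; simpl.
    rewrite taylor_poly_3, b0; unfold Q; simpl; ring. }
  assert (bzQ : bigO 1 (fun z => z * Q z)%C) by exact (bigO_mult 1 0 _ _ bigO_id bQ).
  assert (bg : bigO 1 g).
  { apply (bigO_weaken 1) in hg'; [ | lia].
    eapply bigO_ext; [ | exact (bigO_plus _ _ _ hg' bzQ)]; intros z; simpl; ring. }
  assert (bg0 : bigO 0 g) by (apply (bigO_weaken 0 1); [lia | exact bg]).
  assert (bzQ0 : bigO 0 (fun z => z * Q z)%C) by (apply (bigO_weaken 0 1); [lia | exact bzQ]).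
  assert (h1 : eqmod 4 (fun w => f (g w)) (fun w => P (g w)))
    by exact (bigO_comp _ _ _ hf' bg).
  assert (h2 : eqmod 4 (fun w => P (g w)) (fun w => P (w * Q w)%C)).
  { (* P(x) - P(y) = (x - y) R(x, y) *)
    apply (bigO_ext _ (fun w => (g w - w * Q w)
      * (1 + a 2%nat * (g w + w * Q w)
         + a 3%nat * (g w * g w + g w * (w * Q w) + (w * Q w) * (w * Q w))))%C).
    - intros w; unfold P; simpl; ring.
    - apply (bigO_mult 4 0); [exact hg' | bounded]. }
  assert (h3 : eqmod 4 (fun w => P (w * Q w)%C)
    (fun w => 0 + b 1%nat * w + (b 2%nat + a 2%nat * b 1%nat ^ 2) * w ^ 2
      + (b 3%nat + 2 * a 2%nat * b 1%nat * b 2%nat + a 3%nat * b 1%nat ^ 3) * w ^ 3)%C).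
  { apply (bigO_factor _ _ (fun w =>
      a 2%nat * (2 * b 1%nat * b 3%nat + b 2%nat * b 2%nat
         + 2 * b 2%nat * b 3%nat * w + b 3%nat * b 3%nat * (w * w))
      + a 3%nat * ((b 2%nat + b 3%nat * w)
         * (Q w * Q w + Q w * b 1%nat + b 1%nat * b 1%nat)))%C).
    - bounded.
    - intros w; unfold P, Q; simpl; ring. }
  assert (h4 : eqmod 4 (fun w => 0 + 1 * w + 0 * w ^ 2 + 0 * w ^ 3)%C (fun w => f (g w))).
  { apply (eqmod_germ _ _ _ r hr); intros w hw; rewrite hfg by exact hw; ring. }
  destruct (eqmod_cubic_unique _ _ _ _ _ _ _ _
     (eqmod_trans _ _ _ _ (eqmod_trans _ _ _ _ (eqmod_trans _ _ _ _ h4 h1) h2) h3))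
    as [_ [e1 [e2 e3]]].
  rewrite <- e1 in e2, e3.
  assert (e2' : b 2%nat = (- a 2%nat)%C).
  { replace (b 2%nat) with ((b 2%nat + a 2%nat * 1 ^ 2) - a 2%nat)%C by ring.
    rewrite <- e2; ring. }
  split; [exact e2' | ].
  rewrite e2' in e3.
  replace (b 3%nat) with ((b 3%nat + 2 * a 2%nat * 1 * - a 2%nat + a 3%nat * 1 ^ 3)
     + 2 * a 2%nat ^ 2 - a 3%nat)%C by ring.
  rewrite <- e3; ring.
Qed.

(** Both sides of [C_derive F z = phi (w z)] are expanded modulo [z^3]; [u1] and
    [u2] are the coefficients of the Schwarz function [w]. *)
Lemma subordinate_derivative_coefficients (phi F : C -> C) (B c : nat -> C) (r : R) :
  taylor_on_disc B phi -> analytic_on_disc F -> 0 < r ->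
  (forall z, Cmod z < r ->
     is_pseries (K := C_AbsRing) (V := C_NormedModule) c z (F z)) ->
  subordinate (C_derive F) phi ->
  exists u1 u2 : C,
    Cmod u1 <= 1 /\ Cmod u2 <= 1 - Cmod u1 ^ 2 /\
    (2 * c 2%nat = B 1%nat * u1)%C /\
    (3 * c 3%nat = B 1%nat * u2 + B 2%nat * u1 ^ 2)%C.
Proof.
  intros hB hF hr hc [w [hw [w0 hsub]]].
  destruct (analytic_at_0_pseries w (hw _ disc_0)) as [u [s [hs hu]]].
  assert (u0 : u 0%nat = RtoC 0) by now rewrite <- (pseries_at_0 u w s hs hu).
  pose proof (pseries_eqmod u w s 4 hs hu) as ew5.
  assert (ew : eqmod 5 w
    (fun z => z * (u 1%nat + u 2%nat * z + u 3%nat * z ^ 2 + u 4%nat * z ^ 3))%C).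
  { eapply bigO_ext; [ | exact ew5]; intros z; simpl.
    rewrite taylor_poly_S, taylor_poly_3, u0; simpl; ring. }
  destruct (schwarz_coefficients w _ _ _ _ hw (fun z hz => proj1 (hsub z hz)) ew)
    as [h1 h2].
  exists (u 1%nat), (u 2%nat); split; [exact h1 | split; [exact h2 | ]].
  set (Q := fun z : C => (u 1%nat + u 2%nat * z)%C).
  assert (bQ : bigO 0 Q) by (unfold Q; bounded).
  assert (bzQ : bigO 1 (fun z => z * Q z)%C) by exact (bigO_mult 1 0 _ _ bigO_id bQ).
  assert (ew' : eqmod 3 w (fun z => z * Q z)%C).
  { eapply eqmod_trans; [apply (bigO_weaken 3 5); [lia | exact ew] | ].
    apply (bigO_factor _ _ (fun z => u 3%nat + u 4%nat * z)%C);
      [bounded | intros; unfold Q; simpl; ring]. }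
  assert (bw : bigO 1 w).
  { apply (bigO_weaken 1) in ew'; [ | lia].
    eapply bigO_ext; [ | exact (bigO_plus _ _ _ ew' bzQ)]; intros z; simpl; ring. }
  assert (bw0 : bigO 0 w) by (apply (bigO_weaken 0 1); [lia | exact bw]).
  assert (bzQ0 : bigO 0 (fun z => z * Q z)%C)
    by (apply (bigO_weaken 0 1); [lia | exact bzQ]).
  assert (hphi : eqmod 3 (fun z => phi (w z)) (fun z => taylor_poly B 2 (w z)))
    by exact (bigO_comp _ _ _ (pseries_eqmod B phi 1 2 Rlt_0_1 hB) bw).
  assert (h3 : eqmod 3 (fun z => taylor_poly B 2 (w z))
                       (fun z => taylor_poly B 2 (z * Q z)%C)).
  { apply (bigO_ext _ (fun z => (w z - z * Q z)
      * (B 1%nat + B 2%nat * (w z + z * Q z)))%C).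
    - intros z; rewrite !taylor_poly_S, !taylor_poly_O; simpl; ring.
    - apply (bigO_mult 3 0); [exact ew' | bounded]. }
  assert (h4 : eqmod 3 (fun z => taylor_poly B 2 (z * Q z)%C)
    (fun z => B 0%nat + B 1%nat * u 1%nat * z
       + (B 1%nat * u 2%nat + B 2%nat * u 1%nat ^ 2) * z ^ 2)%C).
  { apply (bigO_factor _ _ (fun z => B 2%nat
        * (2 * u 1%nat * u 2%nat + u 2%nat * u 2%nat * z))%C); [bounded | ].
    intros z; rewrite !taylor_poly_S, !taylor_poly_O; unfold Q; simpl; ring. }
  assert (h5 : eqmod 3 (C_derive F) (fun z => phi (w z))).
  { apply (eqmod_germ _ _ _ 1 Rlt_0_1); intros z hz; now apply hsub. }
  assert (hrd : 0 < Rmin r 1) by (apply Rmin_pos; lra).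
  assert (h6 := C_derive_pseries_eqmod c F (Rmin r 1) hrd
    (fun z hz => hc z (Rlt_le_trans _ _ _ hz (Rmin_l r 1)))
    (fun z hz => hF z (Rlt_le_trans _ _ _ hz (Rmin_r r 1)))).
  pose proof (eqmod_trans _ _ _ _ (eqmod_sym _ _ _ h6)
    (eqmod_trans _ _ _ _ h5
      (eqmod_trans _ _ _ _ hphi (eqmod_trans _ _ _ _ h3 h4)))) as h.
  exact (proj2 (eqmod_quadratic_unique _ _ _ _ _ _ h)).
Qed.

(** The elimination of [u2 + v2] and [u2 - v2] described at the top.  For the
    first bound, [2 a2^2 (3 b^2 - 4 B2 + 4 b) = b^3 (u2 + v2) + 8 b a2^2]; the
    right-hand side is at most [2 b^3 (1 - |u1|^2) + 2 b (b |u1|)^2 = 2 b^3]. *)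
Lemma coefficient_bounds (b : R) (B2 a2 a3 u1 u2 v1 v2 : C) :
  0 < b ->
  Cmod u1 <= 1 -> Cmod u2 <= 1 - Cmod u1 ^ 2 -> Cmod v2 <= 1 - Cmod v1 ^ 2 ->
  (2 * a2 = b * u1)%C -> (3 * a3 = b * u2 + B2 * u1 ^ 2)%C ->
  (2 * - a2 = b * v1)%C -> (3 * (2 * a2 ^ 2 - a3) = b * v2 + B2 * v1 ^ 2)%C ->
  Cmod a2 ^ 2 * Cmod (3 * b ^ 2 - 4 * B2 + 4 * b)%C <= b ^ 3 /\
  Cmod a3 <= (1 / 3 + b / 4) * b.
Proof.
  intros hb hu1 hu2 hv2 e1 e2 e3 e4.
  assert (nb : RtoC b <> RtoC 0) by (intros e; apply RtoC_inj in e; lra).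
  assert (n2 : RtoC 2 <> RtoC 0) by (intros e; apply RtoC_inj in e; lra).
  assert (n3 : RtoC 3 <> RtoC 0) by (intros e; apply RtoC_inj in e; lra).
  assert (mb : Cmod (RtoC b) = b) by (rewrite Cmod_R, Rabs_pos_eq; lra).
  assert (m2 : Cmod (RtoC 2) = 2) by (rewrite Cmod_R, Rabs_pos_eq; lra).
  assert (ea2 : a2 = (b * u1 * / 2)%C) by (rewrite <- e1; field; exact n2).
  assert (ev1 : v1 = (- u1)%C).
  { replace v1 with ((b * v1) * / b)%C by (field; exact nb).
    rewrite <- e3, ea2; field; auto. }
  rewrite ev1, Cmod_opp in hv2; rewrite ev1 in e4.
  assert (ea3 : a3 = ((b * u2 + B2 * u1 ^ 2) * / 3)%C) by (rewrite <- e2; field; exact n3).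
  assert (ma2 : 2 * Cmod a2 = b * Cmod u1).
  { rewrite <- m2 at 1; rewrite <- mb at 1; rewrite <- !Cmod_mult; now f_equal. }
  pose proof (Cmod_ge_0 u1) as hu0.
  split.
  - rewrite <- Cmod_pow, <- Cmod_mult.
    assert (e5 : (2 * (a2 ^ 2 * (3 * b ^ 2 - 4 * B2 + 4 * b))
      = b ^ 3 * (u2 + v2) + 8 * b * a2 ^ 2)%C).
    { assert (e6 : (b * v2 = 3 * (2 * a2 ^ 2 - a3) - B2 * u1 ^ 2)%C)
        by (rewrite e4; ring).
      replace (b ^ 3 * (u2 + v2))%C with (b ^ 2 * (b * u2 + b * v2))%C by ring.
      rewrite e6, ea3, ea2; field; auto. }
    apply (Rmult_le_reg_l 2); [lra | ].
    rewrite <- m2 at 1; rewrite <- Cmod_mult, e5.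
    eapply Rle_trans; [apply Cmod_triangle | ].
    rewrite !Cmod_mult, !Cmod_pow, mb.
    replace (Cmod (RtoC 8)) with 8 by (rewrite Cmod_R, Rabs_pos_eq; lra).
    assert (h1 : Cmod (u2 + v2)%C <= 2 * (1 - Cmod u1 ^ 2)).
    { eapply Rle_trans; [apply Cmod_triangle | lra]. }
    assert (h2 : b ^ 3 * Cmod (u2 + v2)%C <= b ^ 3 * (2 * (1 - Cmod u1 ^ 2)))
      by (apply Rmult_le_compat_l; [apply pow_le; lra | exact h1]).
    replace (8 * b * Cmod a2 ^ 2) with (2 * b * (2 * Cmod a2) ^ 2) by ring.
    rewrite ma2; lra.
  - assert (e5 : (12 * a3 = 3 * (b ^ 2 * u1 ^ 2) + 2 * b * (u2 - v2))%C).
    { assert (e6 : (b * v2 = 3 * (2 * a2 ^ 2 - a3) - B2 * u1 ^ 2)%C)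
        by (rewrite e4; ring).
      replace (2 * b * (u2 - v2))%C with (2 * (b * u2 - b * v2))%C by ring.
      rewrite e6, ea3, ea2; field; auto. }
    apply (Rmult_le_reg_l 12); [lra | ].
    replace 12 with (Cmod (RtoC 12)) at 1 by (rewrite Cmod_R, Rabs_pos_eq; lra).
    rewrite <- Cmod_mult, e5.
    eapply Rle_trans; [apply Cmod_triangle | ].
    rewrite !Cmod_mult, !Cmod_pow, mb, m2.
    replace (Cmod (RtoC 3)) with 3 by (rewrite Cmod_R, Rabs_pos_eq; lra).
    assert (h1 : Cmod (u2 - v2)%C <= 2).
    { unfold Cminus; eapply Rle_trans; [apply Cmod_triangle | ].
      rewrite Cmod_opp; pose proof (pow2_ge_0 (Cmod u1)); lra. }
    assert (b ^ 2 * Cmod u1 ^ 2 <= b ^ 2 * 1).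
    { apply Rmult_le_compat_l; [apply pow2_ge_0 | ].
      rewrite <- (pow1 2); apply pow_incr; lra. }
    nra.
Qed.

Theorem theorem2p1 (phi f : C -> C) (B a : nat -> C)
  (hphi : analytic_on_disc phi)
  (hphi_pos : forall z : C, in_disc z -> 0 < Re (phi z))
  (hphi0 : phi (RtoC 0) = RtoC 1)
  (hphi'0 : Im (C_derive phi (RtoC 0)) = 0 /\ 0 < Re (C_derive phi (RtoC 0)))
  (hphi_sym : forall w : C, image_disc phi w -> image_disc phi (Cconj w))
  (hB : taylor_on_disc B phi)
  (ha : taylor_on_disc a f)
  (hf : H_sigma phi f) :
  let B1 : R := Re (B 1%nat) in
  let B2 : C := B 2%nat in
  ((3 * B1 ^ 2 - 4 * B2 + 4 * B1)%C <> RtoC 0 ->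
   Cmod (a 2%nat) <=
     B1 * sqrt B1 / sqrt (Cmod (3 * B1 ^ 2 - 4 * B2 + 4 * B1)%C)) /\
  Cmod (a 3%nat) <= (1 / 3 + B1 / 4) * B1.
Proof.
  intros B1 B2.
  destruct hf as [[[fan [f0 f'0]] [[_ finj] _]]
                  [g [[[gan _] [r [hr hg]]] [fsub gsub]]]].
  rewrite (C_derive_taylor_on_disc_0 B phi hB hphi) in hphi'0.
  destruct hphi'0 as [imB posB].
  assert (eB1 : B 1%nat = RtoC B1).
  { unfold B1; destruct (B 1%nat) as [x y]; simpl in *; now subst y. }
  assert (a0 : a 0%nat = RtoC 0) by now rewrite <- (pseries_at_0 a f 1 Rlt_0_1 ha).
  assert (a1 : a 1%nat = RtoC 1)
    by now rewrite <- (C_derive_taylor_on_disc_0 a f ha fan).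
  destruct (analytic_at_0_pseries g (gan _ disc_0)) as [b [s [hs hb]]].
  assert (g0 : g (RtoC 0) = RtoC 0).
  { destruct (hg (RtoC 0)) as [h1 h2]; [rewrite Cmod_0; exact hr | ].
    apply finj; [exact h1 | apply disc_0 | now rewrite h2, f0]. }
  assert (b0 : b 0%nat = RtoC 0) by now rewrite <- (pseries_at_0 b g s hs hb).
  destruct (inverse_coefficients f g a b r hr (fun w hw => proj2 (hg w hw))
    (pseries_eqmod a f 1 3 Rlt_0_1 ha) (pseries_eqmod b g s 3 hs hb) a0 a1 b0)
    as [b2 b3].
  destruct (subordinate_derivative_coefficients phi f B a 1 hB fan Rlt_0_1 ha fsub)
    as [u1 [u2 [hu1 [hu2 [e1 e2]]]]].
  destruct (subordinate_derivative_coefficients phi g B b s hB gan hs hb gsub)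
    as [v1 [v2 [_ [hv2 [e3 e4]]]]].
  rewrite eB1 in e1, e2, e3, e4; rewrite b2 in e3; rewrite b3 in e4.
  destruct (coefficient_bounds B1 (B 2%nat) (a 2%nat) (a 3%nat) u1 u2 v1 v2
    posB hu1 hu2 hv2 e1 e2 e3 e4) as [k1 k2].
  split; [ | exact k2].
  intros hD; fold B2 in k1.
  set (D := (3 * B1 ^ 2 - 4 * B2 + 4 * B1)%C) in *.
  assert (hD0 : 0 < Cmod D) by now apply Cmod_gt_0.
  assert (hB1 : 0 < B1) by exact posB.
  assert (hs0 : 0 < sqrt (Cmod D)) by now apply sqrt_lt_R0.
  apply (Rmult_le_reg_r (sqrt (Cmod D))); [exact hs0 | ].
  unfold Rdiv; rewrite Rmult_assoc, Rinv_l, Rmult_1_r by lra.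
  apply Rsqr_incr_0.
  - unfold Rsqr.
    replace (Cmod (a 2%nat) * sqrt (Cmod D) * (Cmod (a 2%nat) * sqrt (Cmod D)))
      with (Cmod (a 2%nat) ^ 2 * (sqrt (Cmod D) * sqrt (Cmod D))) by ring.
    replace (B1 * sqrt B1 * (B1 * sqrt B1)) with (B1 ^ 2 * (sqrt B1 * sqrt B1)) by ring.
    rewrite !sqrt_sqrt by lra; lra.
  - apply Rmult_le_pos; [apply Cmod_ge_0 | lra].
  - apply Rmult_le_pos; [lra | apply sqrt_pos].
Qed.
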